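(* Let $I\subset S$ be a Borel fixed ideal all of whose minimal monomial generators have degree at most $d$, and let $a=\{a_0,a_1,a_2,\dots\}$ be a non-decreasing sequence of non-negative integers with $a_0=0$. Then the complex $\widetilde P_\bullet\otimes_{\widetilde S}\widetilde S/(\Theta_a)$ is a minimal $T$-free resolution of $T/I^{\gamma(a)}$, where $T\cong\widetilde S/(\Theta_a)$ via $x_{i,j}\mapsto x_{i+a_{j-1}}$. In particular (taking $a_i=i$ for all $i$), a minimal free resolution of $T/I^{\mathsf{sq}}$ is given in this way.
   Context: Let $\Bbbk$ be a field and $S=\Bbbk[x_1,\dots,x_n]$. For a monomial ideal $J$, $G(J)$ denotes its set of minimal monomial generators. A monomial ideal $I\subset S$ is Borel fixed (strongly stable) if $m\in G(I)$, $x_i\mid m$ and $j<i$ imply $(x_j/x_i)\,m\in I$. Fix such an $I$ and an integer $d$ with $\deg m\le d$ for all $m\in G(I)$. Let $\widetilde S=\Bbbk[x_{i,j}\mid 1\le i\le n,\ 1\le j\le d]$. A monomial $m\in S$ of degree $e\le d$ is written uniquely as $m=\prod_{i=1}^e x_{\alpha_i}$ with $\alpha_1\le\cdots\le\alpha_e$; set $\widetilde m=\operatorname{b-pol}(m):=\prod_{i=1}^e x_{\alpha_i,i}\in\widetilde S$, and $\widetilde I=\operatorname{b-pol}(I):=(\widetilde m\mid m\in G(I))\subset \widetilde S$. Let $T$ be the polynomial ring over $\Bbbk$ in the variables $x_k$ with $k\in\{i+a_{j-1}\mid 1\le i\le n,\ 1\le j\le d\}$. For $m=\prod_{i=1}^e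 x_{\alpha_i}$ ($\alpha_1\le\cdots\le\alpha_e$) put $m^{\gamma(a)}:=\prod_{i=1}^e x_{\alpha_i+a_{i-1}}\in T$, and $I^{\gamma(a)}:=(m^{\gamma(a)}\mid m\in G(I))\subset T$. When $a_i=i$ for all $i$, $(-)^{\gamma(a)}$ is written $(-)^{\mathsf{sq}}$, so $m^{\mathsf{sq}}=\prod_{i=1}^e x_{\alpha_i+i-1}$ and $I^{\mathsf{sq}}=(m^{\mathsf{sq}}\mid m\in G(I))$. Let $L_a$ be the $\Bbbk$-subspace of $\widetilde S$ spanned by $\{x_{i,j}-x_{i',j'}\mid i+a_{j-1}=i'+a_{j'-1}\}$, and let $\Theta_a$ be a basis of $L_a$. For a monomial $m$ let $\mu(m)=\min\{i: x_i\mid m\}$ and $\nu(m)=\max\{i: x_i\mid m\}$ (with $\mu(1)=\infty$). Every monomial $m\in I$ has a unique expression $m=m_1m_2$ with $\nu(m_1)\le\mu(m_2)$ and $m_1\in G(I)$; put $g(m):=m_1$. For a monomial $m=\prod x_l^{c_l}$ and $i<\nu(m)$ put $\mathfrak b_i(m):=(x_i/x_k)\,m$ with $k=\min\{j>i: c_j>0\}$. For $m\in G(I)$ put $m_{\langle i\rangle}:=g(\mathfrak b_i(m))$ if $1\le i<\nu(m)$, $m_{\langle i\rangle}:=m$ if $i\ge\nu(m)$, and $\widetilde m_{\langle i\rangle}:=\operatorname{b-pol}(m_{\langle i\rangle})$. For a finite set $\widetilde F=\{(i_1,j_1),\dots,(i_q,j_q)\}\subset\mathbb N\times\mathbb N$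 and $m=\prod x_l^{c_l}\in G(I)$, the pair $(\widetilde F,\widetilde m)$ is admissible if (a) $1\le i_1<\cdots<i_q<\nu(m)$ and (b) $j_r=1+\sum_{l=1}^{i_r}c_l$ for all $r$; the pair $(\emptyset,\widetilde m)$ is also admissible. Put $\widetilde F_r:=\widetilde F\setminus\{(i_r,j_r)\}$, and for $(\widetilde F,\widetilde m)$ admissible put $B(\widetilde F,\widetilde m):=\{r\mid 1\le r\le q,\ (\widetilde F_r,\widetilde m_{\langle i_r\rangle})\text{ is admissible}\}$. The complex $\widetilde P_\bullet$ of free $\widetilde S$-modules: $\widetilde P_0=\widetilde S$, and for $q\ge1$, $\widetilde P_q=\bigoplus \widetilde S\,e(\widetilde F,\widetilde m)$, the sum over admissible pairs with $\#\widetilde F=q-1$. The differential $\partial:\widetilde P_{q+1}\to\widetilde P_q$ ($q\ge1$) sends $e(\widetilde F,\widetilde m)$ with $\widetilde F=\{(i_1,j_1),\dots,(i_q,j_q)\}$, $i_1<\dots<i_q$, to $$\sum_{1\le r\le q}(-1)^r x_{i_r,j_r}\,e(\widetilde F_r,\widetilde m)-\sum_{r\in B(\widetilde F,\widetilde m)}(-1)^r\frac{x_{i_r,j_r}\,\widetilde m}{\widetilde m_{\langle i_r\rangle}}\,e(\widetilde F_r,\widetilde m_{\langle i_r\rangle}),$$ and $\partial:\widetilde P_1\to\widetilde P_0$ sends $e(\emptyset,\widetilde m)$ to $\widetilde m$. *)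

(* Defs.v *)
From HB Require Import structures.
From mathcomp Require Import all_boot all_order all_algebra.
From mathcomp Require Import generic_quotient ring_quotient.
From mathcomp Require Import boolp.
From mathcomp Require Import mpoly.

Set Implicit Arguments.
Unset Strict Implicit.
Unset Printing Implicit Defensive.

Import GRing.Theory.
Local Open Scope ring_scope.
Local Open Scope quotient_scope.

Section Span.
Variables (R : nzRingType) (V : lmodType R).

Definition in_span (X : V -> Prop) (v : V) : Prop :=
  exists s : seq (R * V),
    (forall p, p \in s -> X p.2) /\ v = \sum_(p <- s) p.1 *: p.2.

Definition lin_indep (s : seq V) : Prop :=
  forall c : nat -> R, \sum_(i < size s) c i *: s`_i = 0 ->
  forall i, (i < size s)%N -> c i = 0.

Definition basis_of_subspace (L : V -> Prop) (s : seq V) : Prop :=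
  lin_indep s /\ forall v, L v <-> in_span (fun w => w \in s) v.

Lemma in_span0 X : in_span X 0.
Proof. by exists [::]; split=> //; rewrite big_nil. Qed.

Lemma in_spanZD X a u v : in_span X u -> in_span X v -> in_span X (a *: u + v).
Proof.
move=> [s [sX ->]] [t [tX ->]].
exists ([seq (a * p.1, p.2) | p <- s] ++ t); split=> [p|].
  by rewrite mem_cat => /orP[/mapP[x /sX ? ->] //|/tX].
rewrite big_cat big_map scaler_sumr; congr (_ + _).
by apply: eq_bigr => p _; rewrite scalerA.
Qed.

Lemma in_spanB X : zmod_closed (fun v => `[< in_span X v >]).
Proof.
split=> [|u v]; first exact/asboolP/in_span0.
move=> /asboolP Xu /asboolP Xv; apply/asboolP.
rewrite -[u - v](addrC (- v)) -scaleN1r; exact: in_spanZD.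
Qed.

End Span.

Definition ideal_gen (R : comNzRingType) (X : R -> Prop) : R -> Prop :=
  @in_span R R^o X.

Section QuotientModule.
Variables (R : comNzRingType) (X : R -> Prop).

Definition ideal_pred : {pred R} := fun f => `[< ideal_gen X f >].
HB.instance Definition _ :=
  GRing.isZmodClosed.Build R ideal_pred (@in_spanB R R^o X).

(* The R-module R/(X); unlike {ideal_quot _} it does not require (X) to be
   proper. *)
Definition quot_mod := {ideal_quot ideal_pred}.
HB.instance Definition _ := GRing.Zmodule.on quot_mod.
HB.instance Definition _ : @ZmodQuotient R (Quotient.equiv ideal_pred) 0 -%R +%R quot_mod :=
  ZmodQuotient.on quot_mod.

Definition quot_scale (a : R) (x : quot_mod) : quot_mod :=
  \pi_quot_mod (a * repr x).

Lemma pi_eqP (f g : R) :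
  reflect (ideal_gen X (f - g)) (f == g %[mod quot_mod]).
Proof.
rewrite -Quotient.idealrBE; exact: asboolP.
Qed.

Lemma quot_scale_pi a f : quot_scale a (\pi_quot_mod f) = \pi_quot_mod (a * f).
Proof.
apply/eqP/pi_eqP; rewrite -mulrBr.
rewrite -[X in ideal_gen _ X]addr0; apply: in_spanZD; last exact: in_span0.
by apply/pi_eqP; rewrite reprK.
Qed.

Lemma quot_scaleA a b x : quot_scale a (quot_scale b x) = quot_scale (a * b) x.
Proof.
by rewrite -[x]reprK (quot_scale_pi b) (quot_scale_pi a) (quot_scale_pi (a * b)) mulrA.
Qed.

Lemma quot_scale1 : left_id 1 quot_scale.
Proof. by move=> x; rewrite -[x]reprK (quot_scale_pi 1) mul1r. Qed.

Lemma quot_scaleDr : right_distributive quot_scale +%R.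
Proof.
move=> a x y; rewrite -[x]reprK -[y]reprK -(raddfD \pi_quot_mod).
by rewrite (quot_scale_pi a (_ + _)) (quot_scale_pi a (repr x))
  (quot_scale_pi a (repr y)) mulrDr raddfD.
Qed.

Lemma quot_scaleDl x : {morph quot_scale^~ x : a b / a + b}.
Proof.
move=> a b /=; rewrite -[x]reprK (quot_scale_pi (a + b)) (quot_scale_pi a).
by rewrite (quot_scale_pi b) mulrDl raddfD.
Qed.

HB.instance Definition _ := GRing.Zmodule_isLmodule.Build R quot_mod
  quot_scaleA quot_scale1 quot_scaleDr quot_scaleDl.

End QuotientModule.

(* A complex of free R-modules of finite rank, in the form of bases and matrix
   entries: the q-th module is free on fc_basis q and the differential sends
   the basis element c to the sum over b of (fc_diff c b) times b. *)
Record free_complex (R : nzRingType) := FreeComplex {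
  fc_basis : nat -> finType;
  fc_diff : forall q, fc_basis q.+1 -> fc_basis q -> R }.

Definition free_mod (R : nzRingType) (C : free_complex R) (q : nat) : lmodType R :=
  {ffun fc_basis C q -> R^o}.

Definition basis_elt (R : nzRingType) (C : free_complex R) q (b : fc_basis C q) :
  free_mod C q := [ffun b' => (b' == b)%:R].

Definition boundary (R : nzRingType) (C : free_complex R) (q : nat)
    (v : free_mod C q.+1) : free_mod C q :=
  [ffun b => \sum_c v c * fc_diff c b].

(* Extension of scalars along f : R -> R'.  The tensor product of R' with the
   free R-module on B is the free R'-module on B, and f acts on the matrix
   entries of the differentials. *)
Definition base_change (R R' : nzRingType) (f : {rmorphism R -> R'})
    (C : free_complex R) : free_complex R' :=
  FreeComplex (fun q (c : fc_basis C q.+1) (b : fc_basis C q) => f (fc_diff c b)).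

Definition irrelevant_ideal (K : fieldType) (N : nat) : {mpoly K[N]} -> Prop :=
  ideal_gen (fun f => exists i : 'I_N, f = 'X_i).
Arguments irrelevant_ideal {K N}.

(* C is a minimal graded free resolution of the cyclic module {mpoly K[N]}/(X),
   for the standard grading: deg gives the degrees of the basis elements, eps is
   the augmentation, and minimality says that the image of every differential is
   contained in the irrelevant ideal times the target. *)
Definition minimal_free_resolution (K : fieldType) (N : nat)
    (C : free_complex {mpoly K[N]}) (X : {mpoly K[N]} -> Prop) : Prop :=
  exists (eps : {linear free_mod C 0 -> quot_mod X})
         (deg : forall q, fc_basis C q -> nat),
  [/\ [/\ forall y, exists v, eps v = y,
          forall v, eps v = 0 <-> exists w, v = boundary w
        & forall q (v : free_mod C q.+1),
            boundary v = 0 <-> exists w, v = boundary w],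
      (forall b, exists2 f : {mpoly K[N]},
         f \is (deg 0%N b).-homog & eps (basis_elt b) = \pi f),
      (forall q (c : fc_basis C q.+1) (b : fc_basis C q) m,
         m \in msupp (fc_diff c b) -> (mdeg m + deg q b)%N = deg q.+1 c)
    & forall q (v : free_mod C q.+1) b, irrelevant_ideal (boundary v b)].

(* {mpoly K[#|X|]} serves as the polynomial ring over K with variables indexed
   by the finite type X. *)
Definition var_on (K : fieldType) (X : finType) (x : X) : {mpoly K[#|X|]} :=
  'X_(enum_rank x).

Definition mvar_on (X : finType) (x : X) : 'X_{1..#|X|} := U_(enum_rank x)%MM.

Section MonomialCombinatorics.
Variables (K : fieldType) (n : nat) (I : {pred {mpoly K[n]}}).
Implicit Types m : 'X_{1..n}.

Definition monomial_ideal : Prop :=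
  exists M : 'X_{1..n} -> Prop, forall f,
    f \in I <-> ideal_gen (fun g => exists2 m, M m & g = 'X_[m]) f.

Definition mingen m : bool :=
  ('X_[m] \in I) &&
  [forall m' : 'X_{1..n < (mdeg m).+1},
     (bmnm m' <= m)%MM && (bmnm m' != m) ==> ('X_[bmnm m'] \notin I)].

Definition borel_fixed : Prop :=
  forall m, mingen m -> forall i j : 'I_n, (0 < m i)%N -> (j < i)%N ->
  'X_[(m - U_(i)) + U_(j)] \in I.

(* Variables are numbered from 1 in the values of nu and mu, as in the usual
   convention: i : 'I_n stands for x_(i+1).  nu 1 = 0, and the value n.+1 of
   mu at 1 plays the role of infinity. *)
Definition nu m : nat := (\max_(i < n | 0 < m i) i.+1)%N.
Definition mu m : nat := (\big[minn/n.+1]_(i < n | 0 < m i) i.+1)%N.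

(* The Eliahou-Kervaire decomposition function: for m in I, the unique minimal
   generator m1 with m = m1 m2 and nu m1 <= mu m2.  The value is m itself when
   m is not in I. *)
Definition gmon m : 'X_{1..n} :=
  if [pick m1 : 'X_{1..n < (mdeg m).+1} |
        [&& mingen m1, (bmnm m1 <= m)%MM & (nu m1 <= mu (m - m1)%MM)%N]]
  is Some m1 then bmnm m1 else m.

(* (x_i / x_k) m with k the least index > i such that x_k divides m *)
Definition bmove (i : 'I_n) m : 'X_{1..n} :=
  if [pick k : 'I_n | [&& (i < k)%N, (0 < m k)%N &
        [forall l : 'I_n, (i < l)%N && (0 < m l)%N ==> (k <= l)%N]]]
  is Some k then ((m - U_(k)) + U_(i))%MM else m.

(* The generator usually written m_<i> *)
Definition mangle m (i : 'I_n) : 'X_{1..n} :=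
  if (i.+1 < nu m)%N then gmon (bmove i m) else m.

(* The nondecreasing sequence alpha_1, ..., alpha_e of the indices of the
   variables in m *)
Definition alpha m : seq 'I_n := flatten [seq nseq (m i) i | i <- enum 'I_n].

Variable d : nat.

(* The pair (i, j) : 'I_n * 'I_d stands for the variable x_(i+1,j+1) of the
   ring S~ = {mpoly K[#|{: 'I_n * 'I_d}|]}.  All monomials in use have degree at
   most d, so that the product over j < d is over all positions of alpha m. *)
Definition bpol m : 'X_{1..#|{: 'I_n * 'I_d}|} :=
  (\sum_(j < d) if onth (alpha m) j is Some i then mvar_on (i, j) else 0)%MM.

Definition by_row (F : {set 'I_n * 'I_d}) : seq ('I_n * 'I_d) :=
  sort (fun p p' : 'I_n * 'I_d => p.1 <= p'.1)%N (enum F).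

Definition admissible (F : {set 'I_n * 'I_d}) m : bool :=
  [&& mingen m,
      sorted ltn [seq (p.1 : nat) | p : 'I_n * 'I_d <- by_row F],
      [forall p in F, (p.1.+1 < nu m)%N]
    & [forall p in F, p.2 == (\sum_(l < n | l <= p.1) m l)%N :> nat]].

(* (-1)^r, where p is the r-th element of F, counting from 1 *)
Definition row_sign (F : {set 'I_n * 'I_d}) (p : 'I_n * 'I_d) :
    {mpoly K[#|{: 'I_n * 'I_d}|]} :=
  (-1) ^+ (index p (by_row F)).+1.

Definition EKbasis (q : nat) : finType :=
  if q is q'.+1 then
    {p : {set 'I_n * 'I_d} * 'X_{1..n < d.+1} | admissible p.1 p.2 && (#|p.1| == q')}
  else unit.

(* The coefficient of e(F', m') in the image of e(F, m).  The truncated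
   subtraction of exponents computes x_(i,j) m~ / m~_<i>: since b_i(m)~ is
   x_(i,j) m~ / x_(k,j) and m_<i> is an initial factor of b_i(m), m~_<i> divides
   x_(i,j) m~. *)
Definition EKcoef (F : {set 'I_n * 'I_d}) m (F' : {set 'I_n * 'I_d}) m' :
    {mpoly K[#|{: 'I_n * 'I_d}|]} :=
  \sum_(p in F | (F :\ p == F') && (m == m')) row_sign F p * var_on K p
  - \sum_(p in F | admissible (F :\ p) (mangle m p.1)
                   && ((F :\ p == F') && (mangle m p.1 == m')))
       row_sign F p * 'X_[(mvar_on p + bpol m) - bpol (mangle m p.1)].

Definition EKdiff (q : nat) :
    EKbasis q.+1 -> EKbasis q -> {mpoly K[#|{: 'I_n * 'I_d}|]} :=
  match q with
  | 0 => fun c _ => 'X_[bpol (val c).2]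
  | q'.+1 => fun c b => EKcoef (val c).1 (val c).2 (val b).1 (val b).2
  end.

Definition EKcomplex : free_complex {mpoly K[#|{: 'I_n * 'I_d}|]} :=
  FreeComplex EKdiff.

Section Depolarization.
Variable a : nat -> nat.

(* T = {mpoly K[#|labels|]} has the variables x_k with k in the range of label,
   and p = (i-1, j-1) has the label i + a_(j-1). *)
Definition label (p : 'I_n * 'I_d) : nat := (p.1.+1 + a p.2)%N.

Definition labels : finType := seq_sub (codom label).

Definition to_label (p : 'I_n * 'I_d) : labels := SeqSub (codom_f label p).

Definition mgamma m : 'X_{1..#|labels|} :=
  (\sum_(j < d)
     if onth (alpha m) j is Some i then mvar_on (to_label (i, j)) else 0)%MM.

Definition gamma_gens (f : {mpoly K[#|labels|]}) : Prop :=
  exists2 m, mingen m & f = 'X_[mgamma m].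

(* The space of linear forms usually written L_a *)
Definition linear_space : {mpoly K[#|{: 'I_n * 'I_d}|]} -> Prop :=
  in_span (fun f => exists p p', label p = label p' /\ f = var_on K p - var_on K p').

End Depolarization.

Definition sq_gens : {mpoly K[#|labels id|]} -> Prop := @gamma_gens id.

End MonomialCombinatorics.

Arguments gamma_gens {K n} I d a f.
Arguments sq_gens {K n} I d f.
Arguments linear_space K {n d} a f.

Section ThetaIdeal.
Variables (K : fieldType) (n d : nat) (a : nat -> nat).
Variable Theta : seq {mpoly K[#|{: 'I_n * 'I_d}|]}.

(* The ideal (Theta).  The hypothesis on Theta is an argument because it is
   needed to infer that the ideal is proper. *)
Definition theta_ideal (_ : basis_of_subspace (linear_space K a) Theta) :
    {pred {mpoly K[#|{: 'I_n * 'I_d}|]}} :=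
  ideal_pred (fun f => f \in Theta).

Variable Theta_basis : basis_of_subspace (linear_space K a) Theta.

Lemma theta_idealr_closed : idealr_closed (theta_ideal Theta_basis).
Proof.
split; first exact/asboolP/in_span0.
  apply/asboolP => -[s [sT /(congr1 (mcoeff 0))]].
  rewrite mcoeff1 eqxx raddf_sum big_seq big1 => [/eqP|p /sT pT].
    by rewrite oner_eq0.
  rewrite /= rmorphM /=; suff -> : p.2@_0 = 0 by rewrite mulr0.
  have /Theta_basis.2[t [tL ->]] : in_span (fun w => w \in Theta) p.2.
    exists [:: (1, p.2)]; split=> [q|]; first by rewrite inE => /eqP->.
    by rewrite big_seq1 scale1r.
  rewrite raddf_sum big_seq big1 // => q /tL[u [v [_ ->]]] /=.
  by rewrite mcoeffZ mcoeffB !mcoeffX !mnm1_eq0 subrr mulr0.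
move=> b u v /asboolP Tu /asboolP Tv; apply/asboolP; exact: in_spanZD.
Qed.

HB.instance Definition _ :=
  isIdealr.Build {mpoly K[#|{: 'I_n * 'I_d}|]} (theta_ideal Theta_basis) theta_idealr_closed.

End ThetaIdeal.

(* Main.v *)
Require Import Defs.
From mathcomp Require Import all_boot all_order all_algebra.
From mathcomp Require Import generic_quotient ring_quotient.
From mathcomp Require Import mpoly.
From HB Require Import structures.
From mathcomp Require Import boolp zify ring.

Set Implicit Arguments.
Unset Strict Implicit.
Unset Printing Implicit Defensive.

Import GRing.Theory.
Local Open Scope ring_scope.
Local Open Scope quotient_scope.

(* A monomial is read as its nondecreasing word of letters.  For m in G(I) and
   i < nu m, the generator m_<i> is the shortest initial word lying in I of the word
   of m in which the first letter exceeding i is replaced by i.  After depolarization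
   the complex is still multigraded by the monomials of T, with entries +-1 times a
   monomial, so that exactness can be checked on the strand of each multidegree D,
   which is a complex of finite-dimensional K-spaces.

   Order G(I) lexicographically by words; then m_<i> precedes m, and the strand is
   filtered by generators.  As a is non-decreasing, the variables x_(i + a_(j-1))
   attached to m for the corners (i, j), i < nu m, are pairwise distinct, hence the
   subquotient of the strand at m is the augmented chain complex of the full simplex
   on the corners (i, j) such that m^gamma x_(i + a_(j-1)) divides D.  It is
   contractible unless there is no such corner, and this happens only for the
   lexicographically first m such that m^gamma divides D: if w precedes m and w^gamma
   divides D, the first letter in which w differs from m gives such a corner. *)

(** * Words of monomials *)

Section Words.
Variable n : nat.
Implicit Types (m : 'X_{1..n}) (s : seq 'I_n) (i j : 'I_n).

Definition leo : rel 'I_n := fun i j => (i <= j)%N.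

Lemma leo_anti : antisymmetric leo.
Proof. by move=> i j /anti_leq /val_inj. Qed.

Lemma count_alpha m i : count_mem i (alpha m) = m i.
Proof.
rewrite /alpha count_flatten -map_comp sumnE big_map big_enum /=.
rewrite (bigD1 i) //= count_nseq /= eqxx mul1n big1 ?addn0 // => j /negbTE ji.
by rewrite count_nseq /= ji.
Qed.

Lemma size_alpha m : size (alpha m) = mdeg m.
Proof.
rewrite /alpha size_flatten /shape -map_comp sumnE big_map big_enum /= mdegE.
by apply: eq_bigr => i _; rewrite size_nseq.
Qed.

Lemma alpha_sorted m : pairwise leo (alpha m).
Proof.
have : pairwise leo (enum 'I_n).
  rewrite -[pairwise _ _](@pairwise_map _ _ val leq) val_enum_ord.
  by rewrite -sorted_pairwise ?iota_sorted //; exact: leq_trans.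
rewrite /alpha; elim: (enum _) => //= i s IHs /andP[lei /IHs sP].
rewrite pairwise_cat sP andbT; apply/andP; split; last first.
  elim: (m i) => //= k ->; rewrite andbT all_nseq /leo leqnn orbT //.
apply/allrelP => x y; rewrite mem_nseq => /andP[_ /eqP->] /flattenP[t /mapP[z zs ->]].
by rewrite mem_nseq => /andP[_ /eqP->]; exact: (allP lei).
Qed.

Definition word_mon s : 'X_{1..n} := [multinom count_mem i s | i < n].

Lemma alphaK m : word_mon (alpha m) = m.
Proof. by apply/mnmP => i; rewrite mnmE count_alpha. Qed.

Lemma alpha_eq m s : pairwise leo s -> word_mon s = m -> alpha m = s.
Proof.
move=> sS <-; apply: (pairwise_eq leo_anti (alpha_sorted _) sS).
by apply/allP => i _ /=; rewrite count_alpha mnmE.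
Qed.

Lemma word_mon_cat s1 s2 : word_mon (s1 ++ s2) = (word_mon s1 + word_mon s2)%MM.
Proof. by apply/mnmP => i; rewrite mnmDE !mnmE count_cat. Qed.

Lemma word_mon_cons i s : word_mon (i :: s) = (U_(i) + word_mon s)%MM.
Proof. by apply/mnmP => j; rewrite mnmDE !mnmE. Qed.

Lemma alpha_mem m i : (i \in alpha m) = (0 < m i)%N.
Proof. by rewrite -count_alpha -has_count has_pred1. Qed.

(** As the word is nondecreasing, this is the zero-based position of its first letter exceeding [i],
    that is, j - 1 for the column j attached to the row [i] in an admissible pair. *)
Definition pos m i := count (fun l : 'I_n => l <= i)%N (alpha m).

Lemma posE m i : pos m i = (\sum_(l < n | l <= i) m l)%N.
Proof.
rewrite /pos /alpha count_flatten -map_comp sumnE big_map big_enum /= [RHS]big_mkcond.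
by apply: eq_bigr => l _; rewrite /= count_nseq; case: leqP; rewrite ?mul1n.
Qed.

Lemma split_at i s : pairwise leo s -> exists s1 s2,
  [/\ s = s1 ++ s2, all (fun l : 'I_n => l <= i)%N s1,
      all (fun l : 'I_n => i < l)%N s2 & count (fun l : 'I_n => l <= i)%N s = size s1].
Proof.
move=> sS; pose a := [pred l : 'I_n | l <= i]%N.
exists (filter a s), (filter (predC a) s); split.
- apply/esym/(pairwise_eq leo_anti _ sS); last by rewrite perm_filterC.
  rewrite pairwise_cat !pairwise_filter // !andbT; apply/allrelP => x y.
  rewrite !mem_filter /= -ltnNge => /andP[xi _] /andP[iy _].
  exact/ltnW/(leq_ltn_trans xi).
- exact: filter_all.
- by under eq_all => l do rewrite ltnNge; exact: (@filter_all _ (predC a)).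
- by rewrite size_filter.
Qed.

(* Junk value 0 past the end of the word. *)
Definition letter m t : nat := nth 0%N (map val (alpha m)) t.

Lemma letter_ext m m' : mdeg m = mdeg m' ->
  (forall t, t < mdeg m -> letter m t = letter m' t)%N -> m = m'.
Proof.
move=> sz eqt; rewrite -[m]alphaK -[m']alphaK; congr word_mon.
apply: (inj_map val_inj); apply: (@eq_from_nth _ 0%N).
  by rewrite !size_map !size_alpha.
by move=> t; rewrite size_map size_alpha; exact: eqt.
Qed.

Lemma letter_le m t t' : (t <= t' < mdeg m)%N -> (letter m t <= letter m t')%N.
Proof.
move=> /andP[tt' t'm].
have : sorted leq (map val (alpha m)).
  by rewrite sorted_pairwise ?pairwise_map ?alpha_sorted //; exact: leq_trans.
move/(sorted_leq_nth leq_trans leqnn 0%N); apply=> //.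
  by rewrite inE size_map size_alpha (leq_ltn_trans tt').
by rewrite inE size_map size_alpha.
Qed.

Lemma letter_lt m t : (t < mdeg m)%N -> (letter m t < n)%N.
Proof.
rewrite -size_alpha -(size_map val) => tm.
by have /mapP[i _] := mem_nth 0%N tm; rewrite /letter => ->; exact: ltn_ord.
Qed.

(** The letters at most [i] form the initial segment of length [pos m i]. *)
Lemma ltn_pos m i t : (t < mdeg m)%N -> (t < pos m i)%N = (letter m t <= i)%N.
Proof.
have [s1 [s2 [E /allP s1P /allP s2P C]]] := split_at i (alpha_sorted m).
rewrite /letter /pos C -size_alpha E map_cat nth_cat size_map size_cat => tm.
case: ltnP => [ts1|s1t].
  have := mem_nth 0%N (_ : t < size (map val s1))%N.
  by rewrite size_map => /(_ ts1)/mapP[l ls ->]; rewrite /= s1P.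
have := mem_nth 0%N (_ : t - size s1 < size (map val s2))%N.
rewrite size_map ltn_subLR // => /(_ tm)/mapP[l ls ->].
by rewrite leqNgt s2P.
Qed.

Lemma pos_le m i : (pos m i <= mdeg m)%N.
Proof. by rewrite -size_alpha count_size. Qed.

(** Both sides say that some letter exceeds [i]; the successor on the left is there because [nu]
    numbers variables from 1. *)
Lemma ltn_nu m i : (i.+1 < nu m)%N = (pos m i < mdeg m)%N.
Proof.
apply/idP/idP => [|lt].
  apply: contraLR; rewrite -!leqNgt => le.
  apply/bigmax_leqP => l; rewrite -alpha_mem ltnS.
  have : count (fun l : 'I_n => l <= i)%N (alpha m) == size (alpha m).
    by rewrite size_alpha eqn_leq (pos_le m i).
  by rewrite -all_count => /allP; apply.
have [s1 [s2 [E _ /allP s2P C]]] := split_at i (alpha_sorted m).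
move: lt; rewrite /pos C -size_alpha E size_cat -[X in (X < _)%N]addn0 ltn_add2l.
case: s2 E s2P => // l s2 E /(_ l (mem_head _ _)) il _.
have ml : (0 < m l)%N by rewrite -alpha_mem E mem_cat mem_head orbT.
by rewrite (leq_ltn_trans il) // /nu (bigmax_sup l).
Qed.

End Words.

(** * Borel-fixed ideals *)

Section Borel.
Variables (K : fieldType) (n : nat) (I : idealr {mpoly K[n]}).
Hypothesis I_borel : borel_fixed I.
Implicit Types (m : 'X_{1..n}) (s : seq 'I_n) (i j : 'I_n).

Definition mon_in m := 'X_[m] \in (I : {pred {mpoly K[n]}}).

Lemma mon_in_le m m' : (m <= m')%MM -> mon_in m -> mon_in m'.
Proof. by move=> mm' Im; rewrite /mon_in -(submK mm') mpolyXD idealMr. Qed.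

Lemma mingen_in m : mingen I m -> mon_in m.
Proof. by case/andP. Qed.

Lemma mingen_min m m' : mingen I m -> mon_in m' -> (m' <= m)%MM -> m' = m.
Proof.
case/andP=> _ /forallP min Im' le; apply/eqP/negP => /negP ne.
have lt : (mdeg m' < (mdeg m).+1)%N by rewrite ltnS -(submK le) mdegD leq_addl.
by have := min (BMultinom lt); rewrite /= le ne /=; move/negP; apply.
Qed.

Lemma mdeg_lt m m' : (m' <= m)%MM -> m' != m -> (mdeg m' < mdeg m)%N.
Proof.
move=> le ne; rewrite -(submK le) mdegD -[X in (X < _)%N]add0n ltn_add2r lt0n mdeg_eq0.
by apply: contra ne => /eqP E; rewrite -(submK le) E add0m.
Qed.

Lemma mingen_ex m : mon_in m -> exists2 g, mingen I g & (g <= m)%MM.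
Proof.
elim: {m}_.+1 {-2}m (ltnSn (mdeg m)) => // k IHk m mk Im.
have [gm|] := boolP (mingen I m); first by exists m; rewrite ?lepm_refl.
rewrite /mingen [_ \in _]Im /= negb_forall => /existsP[m' /=].
rewrite negb_imply negbK => /andP[/andP[le ne] Im'].
have m'k : (mdeg m' < k)%N by exact: leq_trans (mdeg_lt le ne) _.
by have [g gg gm'] := IHk m' m'k Im'; exists g => //; exact: lepm_trans le.
Qed.

(** Borel fixedness is assumed on minimal generators only. A generator [g] dividing m x_j either
    divides [m], or contains x_j to a higher power than [m] does, and then g x_i / x_j divides m
    x_i. *)
Lemma borel_move m i j : (i < j)%N -> mon_in (m + U_(j))%MM -> mon_in (m + U_(i))%MM.
Proof.
move=> ij /mingen_ex[g gg le]; have [gm|gm] := boolP (g <= m)%MM.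
  by apply: (mon_in_le (lepm_trans gm (lem_addr _ _))); exact: mingen_in.
have [l ml] : exists l, (m l < g l)%N.
  by move: gm; rewrite /lem negb_forall => /existsP[l]; rewrite -ltnNge; exists l.
have jl : j = l.
  apply/eqP; move/mnm_lepP/(_ l): le; rewrite mnmDE mnm1E; case: eqP => // _.
  by rewrite addn0 leqNgt ml.
rewrite -{l}jl in ml; have gj : (0 < g j)%N by exact: leq_ltn_trans ml.
apply: mon_in_le (I_borel gg gj ij); apply/mnm_lepP => l.
rewrite !mnmDE mnmBE leq_add2r leq_subLR addnC.
by move/mnm_lepP/(_ l): le; rewrite mnmDE addnC.
Qed.

(** The factor [m] makes the induction go through: it absorbs the first letter while the later ones
    are lowered. *)
Lemma borel_dominate s s' m :
  all2 (@leo n) s s' -> mon_in (m + word_mon s')%MM -> mon_in (m + word_mon s)%MM.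
Proof.
elim: s s' m => [|i s IHs] [|j s'] //= m /andP[ij ss'].
rewrite !word_mon_cons !addmA => /(IHs _ _ ss').
rewrite -!addmA [(U_(j) + _)%MM]addmC [(U_(i) + _)%MM]addmC !addmA.
move: ij; rewrite /leo leq_eqVlt => /orP[/eqP/val_inj->//|]; exact: borel_move.
Qed.

Lemma all2_belast i s : path (@leo n) i s -> all2 (@leo n) (belast i s) s.
Proof. by elim: s i => //= j s IHs i /andP[-> /IHs]. Qed.

(* Removing any letter of s gives a word dominating the one obtained by removing
   the last letter, so only the initial words of s need to be tested. *)
Lemma mingen_word s : pairwise (@leo n) s -> mon_in (word_mon s) ->
  (forall k, k < size s -> ~~ mon_in (word_mon (take k s)))%N -> mingen I (word_mon s).
Proof.
move=> sS Is min; apply/andP; split=> //; apply/forallP => m'.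
apply/implyP; move: (bmnm m') => {}m' /andP[le ne]; apply/negP => Im'.
have [i mi] : exists i, (m' i < word_mon s i)%N.
  apply/existsP; rewrite -[[exists _, _]]negbK negb_exists; apply: contra ne => /forallP H.
  apply/eqP/mnmP => i; apply/eqP; rewrite eqn_leq (mnm_lepP le) /=.
  by rewrite leqNgt H.
have /splitPr E : i \in s by rewrite -has_pred1 has_count; move: mi; rewrite mnmE; case: count.
case: E sS Is min mi le {ne} => s1 s2 sS Is min mi le.
have := min (size (s1 ++ belast i s2)); rewrite lastI -cats1 catA.
rewrite take_size_cat // [size (_ ++ [:: _])]size_cat addn1 ltnSn => /(_ isT)/negP; apply.
rewrite word_mon_cat; apply: (@borel_dominate _ s2).
  apply: all2_belast; move: sS; rewrite pairwise_cat => /and3P[_ _].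
  exact: pairwise_sorted.
rewrite -word_mon_cat; apply: mon_in_le Im'; apply/mnm_lepP => l.
move/mnm_lepP/(_ l): le; move: mi; rewrite !mnmE !count_cat /=.
by case: (eqVneq i l) => [<-|_] /=; rewrite ?eqxx ?add0n // add1n addnS ltnS.
Qed.

Lemma mingen_take m k : mingen I m -> (k < mdeg m)%N ->
  ~~ mon_in (word_mon (take k (alpha m))).
Proof.
move=> gm km; apply/negP => Ik.
have le : (word_mon (take k (alpha m)) <= m)%MM.
  by rewrite -[X in (_ <= X)%MM]alphaK -[X in (_ <= word_mon X)%MM](cat_take_drop k) word_mon_cat lem_addr.
have /(congr1 (@mdeg n)) := mingen_min gm Ik le.
have sE : alpha (word_mon (take k (alpha m))) = take k (alpha m).
  apply: alpha_eq => //.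
  by move: (alpha_sorted m); rewrite -{1}(cat_take_drop k (alpha m)) pairwise_cat => /and3P[].
by rewrite -[LHS]size_alpha sE size_take size_alpha km => E; rewrite E ltnn in km.
Qed.

Lemma mu_le m i : (0 < m i)%N -> (mu m <= i.+1)%N.
Proof.
move=> mi; rewrite /mu; have := mem_index_enum i; elim: (index_enum _) => //= j r IHr.
rewrite inE big_cons => /orP[/eqP<-|/IHr le]; first by rewrite mi geq_minl.
by case: ifP => // _; rewrite geq_min le orbT.
Qed.

(** The inequality between [nu] and [mu] says that the word of [m] is the word of the generator
    followed by that of the cofactor. The search succeeds, because the shortest initial word lying
    in I is a minimal generator by [mingen_word]. *)
Lemma gmonP m : mon_in m -> mingen I (gmon I m) /\ prefix (alpha (gmon I m)) (alpha m).
Proof.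
move=> Im; rewrite /gmon.
have prefS s1 s2 : alpha m = s1 ++ s2 -> [/\ pairwise (@leo n) s1,
    pairwise (@leo n) s2 & {in s1 & s2, forall x y, leo x y}].
  by move=> E; move: (alpha_sorted m); rewrite E pairwise_cat => /and3P[/allrelP].
case: pickP => [m1 /and3P[gm1 le num]|].
  split=> //; apply/prefixP; exists (alpha (m - m1)%MM).
  apply: alpha_eq; last by rewrite word_mon_cat !alphaK addmC submK.
  rewrite pairwise_cat !alpha_sorted !andbT; apply/allrelP => x y.
  rewrite !alpha_mem => xm ym.
  have h1 : (x.+1 <= nu m1)%N by rewrite /nu (bigmax_sup x).
  by have := leq_trans h1 (leq_trans num (mu_le ym)).
have ex : exists k, mon_in (word_mon (take k (alpha m))).
  by exists (mdeg m); rewrite -size_alpha take_size alphaK.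
case: (ex_minnP ex) => k Ik kmin none; exfalso.
set s1 := take k (alpha m) in Ik; set s2 := drop k (alpha m).
have E : alpha m = s1 ++ s2 by rewrite cat_take_drop.
have [s1S s2S s12] := prefS _ _ E.
have mE : m = (word_mon s1 + word_mon s2)%MM by rewrite -word_mon_cat -E alphaK.
have le : (word_mon s1 <= m)%MM by rewrite mE lem_addr.
have lt : (mdeg (word_mon s1) < (mdeg m).+1)%N by rewrite ltnS mE mdegD leq_addr.
have := none (BMultinom lt); rewrite /= le /= => /negP; apply; apply/andP; split.
  apply: mingen_word => // l; rewrite size_take_min leq_min => /andP[lk _].
  rewrite /s1 take_takel 1?ltnW //; apply/negP => /kmin.
  by rewrite leqNgt lk.
have -> : (m - word_mon s1)%MM = word_mon s2 by rewrite mE addmC addmK.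
apply/bigmax_leqP => x; rewrite mnmE -has_count has_pred1 => xs1.
(* The neutral value [n.+1] of the minimum bounds every [x.+1], which covers the cofactor 1. *)
rewrite /mu; elim/big_ind: _ => [|u v xu xv|y].
- exact/ltnW/ltn_ord.
- by rewrite leq_min xu.
- by rewrite mnmE -has_count has_pred1; exact: s12.
Qed.

(** The letter [k] is the first one exceeding [i]. Everything before it is at most [i] and
    everything after it exceeds [i], so the word stays nondecreasing when [i] is written in its
    place. *)
Lemma alpha_bmove m i : (pos m i < mdeg m)%N -> exists s1 k s2,
  [/\ alpha m = s1 ++ k :: s2, (i < k)%N, size s1 = pos m i &
      alpha (bmove i m) = s1 ++ i :: s2].
Proof.
have [s1 [s2 [E /allP s1i /allP s2i C]]] := split_at i (alpha_sorted m).
rewrite {1}/pos C -size_alpha E size_cat -[X in (X < _)%N]addn0 ltn_add2l.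
case: s2 E s2i => // k s2 E s2i _; exists s1, k, s2.
have ik := s2i k (mem_head _ _).
have sorted_m := alpha_sorted m; rewrite E in sorted_m.
have min_k (l : 'I_n) : (i < l)%N -> (0 < m l)%N -> (k <= l)%N.
  rewrite -alpha_mem E mem_cat inE => il /or3P[/s1i|/eqP->//|ls2].
    by rewrite leqNgt il.
  move: sorted_m; rewrite pairwise_cat /= => /and4P[_ _ /allP ks2 _]; exact: ks2.
have mk : (0 < m k)%N by rewrite -alpha_mem E mem_cat mem_head orbT.
split=> //; apply: alpha_eq.
  move: sorted_m; rewrite !pairwise_cat /= => /and4P[s12 -> s2k ->]; rewrite andbT /=.
  move/allrelP: s12 => s12; apply/andP; split.
    apply/allrelP => x y xs; rewrite inE => /predU1P[->|ys]; first exact: s1i.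
    by apply: s12 => //; rewrite inE ys orbT.
  by apply/allP => y ys; apply/ltnW/s2i; rewrite inE ys orbT.
rewrite /bmove; case: pickP => [k' /and3P[ik' mk' /forallP min]|/(_ k)]; last first.
  by rewrite ik mk /= => /negP[]; apply/forallP => l; apply/implyP => /andP[]; exact: min_k.
have -> : k' = k.
  apply/val_inj/anti_leq; rewrite min_k // andbT.
  by have := min k; rewrite ik mk.
rewrite -[m in (m - _)%MM]alphaK E !word_mon_cat !word_mon_cons.
by apply/mnmP => l; rewrite !(mnmDE, mnmBE); lia.
Qed.

Lemma bmove_in m i : mon_in m -> (pos m i < mdeg m)%N -> mon_in (bmove i m).
Proof.
move=> Im /alpha_bmove[s1 [k [s2 [E ik _ E']]]].
have moveE j : (word_mon s1 + word_mon s2 + U_(j))%MM = word_mon (s1 ++ j :: s2).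
  by rewrite word_mon_cat word_mon_cons -addmA [(_ + U_(j))%MM]addmC.
by rewrite -[bmove i m]alphaK E' -moveE; apply: (borel_move ik); rewrite moveE -E alphaK.
Qed.

(** If [m'] were shorter, the initial word of [m] of length [mdeg m'] would be letterwise at most
    the word of [m'], hence in I, against the minimality of [m]. *)
Lemma generator_mdeg_le m m' : mingen I m -> mingen I m' ->
  (forall t, t < minn (mdeg m) (mdeg m') -> letter m t <= letter m' t)%N ->
  (mdeg m <= mdeg m')%N.
Proof.
move=> gm gm' le; rewrite leqNgt; apply/negP => lt.
have /negP := mingen_take gm lt; apply; rewrite -[word_mon _]add0m.
apply: (@borel_dominate _ (alpha m')); last by rewrite add0m alphaK; exact: mingen_in.
have sz : size (take (mdeg m') (alpha m)) = size (alpha m').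
  by rewrite size_take !size_alpha lt.
have [/size0nil E|] := posnP (size (alpha m')).
  by move: sz; rewrite E => /size0nil ->.
case E: (alpha m') => [//|x0 s0] _; rewrite -E.
rewrite all2E sz eqxx /=; apply/(all_nthP (x0, x0)) => t.
rewrite size_zip sz minnn size_alpha => tm; rewrite nth_zip //=.
have := le t; rewrite leq_min tm (ltn_trans tm lt) => /(_ isT).
rewrite /letter !(nth_map x0) ?size_alpha //; last exact: ltn_trans tm lt.
by rewrite nth_take.
Qed.

(** Agreement on the common range forces equal lengths. Later identities between generators are
    proved by this comparison, without computing where the words are cut. *)
Lemma generator_ext m m' : mingen I m -> mingen I m' ->
  (forall t, t < minn (mdeg m) (mdeg m') -> letter m t = letter m' t)%N -> m = m'.
Proof.
move=> gm gm' E; have szE : mdeg m = mdeg m'.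
  apply/anti_leq; rewrite !generator_mdeg_le // => t.
    by rewrite minnC => /E->.
  by move/E->.
by apply: letter_ext => // t tm; apply: E; rewrite -szE minnn.
Qed.

(** The replaced letter survives the cut: a generator of length at most [pos m i] would be an
    initial word of [m] itself, hence equal to [m], which is longer. *)
Lemma mangleP m i : mingen I m -> (pos m i < mdeg m)%N ->
  [/\ mingen I (mangle I m i), (pos m i < mdeg (mangle I m i) <= mdeg m)%N &
      forall t, (t < mdeg (mangle I m i))%N ->
        letter (mangle I m i) t = if t == pos m i then i : nat else letter m t].
Proof.
move=> gm lt; rewrite /mangle ltn_nu lt.
have [gm' /prefixP[r E']] := gmonP (bmove_in (mingen_in gm) lt).
have [s1 [k [s2 [E ik sz]]]] := alpha_bmove lt; rewrite E' => Eb.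
set m' := gmon _ _ in gm' E' Eb *.
have letterE t : (t < mdeg m')%N ->
    letter m' t = if t == pos m i then i : nat else letter m t.
  move=> tm; have -> : letter m' t = nth 0%N (map val (s1 ++ i :: s2)) t.
    by rewrite -Eb map_cat nth_cat size_map size_alpha tm.
  rewrite /letter E !map_cat !nth_cat !size_map sz /=.
  case: ltngtP => [tlt|plt|->]; rewrite ?subnn //.
  by rewrite -(subnSK plt).
split=> //.
have le : (mdeg m' <= mdeg m)%N.
  by rewrite -!size_alpha E size_cat /= -[(size s2).+1]/(size (i :: s2)) -size_cat -Eb size_cat leq_addr.
rewrite le andbT ltnNge; apply/negP => le'.
have m'E : m' = m.
  apply: generator_ext => // t; rewrite leq_min => /andP[tm _]; rewrite letterE //.
  by rewrite (ltn_eqF (leq_trans tm le')).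
by move: le'; rewrite m'E leqNgt lt.
Qed.

End Borel.

(** * Admissible pairs *)

Section Symbols.
Variables (K : fieldType) (n d : nat) (I : idealr {mpoly K[n]}).
Hypothesis I_borel : borel_fixed I.
Implicit Types (m : 'X_{1..n}) (F G : {set 'I_n * 'I_d}) (p q : 'I_n * 'I_d).

(** The admissibility conditions on a single pair (i, j), with zero-based entries; by [ltn_nu], the
    bound on the position amounts to i < nu m. *)
Definition corner m p : bool := (pos m p.1 == p.2) && (p.2 < mdeg m)%N.

Lemma corner_inj m p q : corner m p -> corner m q -> p.1 = q.1 -> p = q.
Proof.
case: p q => [i j] [i' j'] /andP[/eqP pj _] /andP[/eqP qj _] /= E; subst i'.
by congr pair; apply: val_inj; rewrite /= -pj qj.
Qed.

(** A corner is determined by its row, so sorting corners by rows gives a strictly increasing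
    sequence; the remaining conditions are tested element by element. *)
Lemma admissibleE F m : admissible I F m = mingen I m && [forall p in F, corner m p].
Proof.
apply/and4P/andP => [[gm _ /forall_inP nuF /forall_inP posF]|[gm /forall_inP cF]].
  split=> //; apply/forall_inP => p pF; have := nuF p pF; have := posF p pF.
  by rewrite /corner ltn_nu -posE eq_sym => /eqP<-; rewrite eqxx.
split=> //.
- rewrite ltn_sorted_uniq_leq map_inj_in_uniq ?sort_uniq ?enum_uniq /=.
    rewrite sorted_map; apply: (sort_sorted (leT := fun p q => p.1 <= q.1)%N).
    by move=> p q; exact: leq_total.
  move=> p q; rewrite !mem_sort !mem_enum => pF qF /val_inj.
  exact: corner_inj (cF p pF) (cF q qF).
- by apply/forall_inP => p /cF/andP[/eqP pE lt]; rewrite ltn_nu pE.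
- by apply/forall_inP => p /cF/andP[/eqP pE _]; rewrite -posE pE.
Qed.

Lemma admissibleD1 F m p : p \in F ->
  admissible I F m = corner m p && admissible I (F :\ p) m.
Proof.
move=> pF; rewrite !admissibleE andbCA; congr (_ && _).
apply/forall_inP/andP => [cF|[cp /forall_inP cF] q qF].
  by split; [exact: cF | apply/forall_inP => q /setD1P[_ /cF]].
by have [->//|qp] := eqVneq q p; apply: cF; rewrite !inE qp.
Qed.

Lemma admissible_gen F m : admissible I F m -> mingen I m.
Proof. by rewrite admissibleE => /andP[]. Qed.

Lemma admissible_corner F m p : admissible I F m -> p \in F -> corner m p.
Proof. by rewrite admissibleE => /andP[_ /forall_inP]; apply. Qed.

Lemma admissible_sub F G m : G \subset F -> admissible I F m -> admissible I G m.
Proof.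
move=> /subsetP GF; rewrite !admissibleE => /andP[-> /forall_inP cF] /=.
by apply/forall_inP => p /GF/cF.
Qed.

Lemma cornerP m p :
  reflect [/\ (p.2 < mdeg m)%N, (p.1 < letter m p.2)%N &
              forall t, (t < p.2)%N -> (letter m t <= p.1)%N] (corner m p).
Proof.
apply: (iffP andP) => [[/eqP pE lt]|[lt gt le]].
  split=> // [|t]; first by rewrite ltnNge -ltn_pos // pE ltnn.
  by rewrite -pE => tp; rewrite -ltn_pos // (ltn_trans tp) // pE.
split=> //; rewrite eqn_leq; apply/andP; split.
  by rewrite leqNgt ltn_pos // -ltnNge.
rewrite leqNgt; apply/negP => h; have := le _ h.
by rewrite -ltn_pos ?ltnn // (ltn_trans h).
Qed.

Lemma corner_mono m p q : corner m p -> corner m q -> (p.1 <= q.1)%N -> (p.2 <= q.2)%N.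
Proof.
move=> /cornerP[pm _ lep] /cornerP[qm gtq _] pq; rewrite leqNgt; apply/negP => qp.
by have := leq_trans gtq (leq_trans (lep _ qp) pq); rewrite ltnn.
Qed.

Lemma mangle_corner m p : mingen I m -> corner m p ->
  [/\ mingen I (mangle I m p.1), (p.2 < mdeg (mangle I m p.1) <= mdeg m)%N &
      forall t, (t < mdeg (mangle I m p.1))%N ->
        letter (mangle I m p.1) t = if t == p.2 then p.1 : nat else letter m t].
Proof. by move=> gm /andP[/eqP pE lt]; have := @mangleP _ _ _ I_borel m p.1 gm; rewrite pE; apply. Qed.

(** A corner in a lower row sits at a position at most [p.2]: the letters before it are unchanged,
    and if it sits at [p.2], the new letter [p.1] still exceeds its row. *)
Lemma corner_mangle_lt m p (t : 'I_n * 'I_d) : mingen I m -> corner m p -> corner m t ->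
  (t.1 < p.1)%N -> corner (mangle I m p.1) t.
Proof.
move=> gm cp ct tp; have [_ /andP[pl _] E] := mangle_corner gm cp.
have le := corner_mono ct cp (ltnW tp).
move/cornerP: ct => [tm gt let_]; apply/cornerP; split.
- exact: leq_ltn_trans pl.
- by rewrite E ?(leq_ltn_trans le) //; case: eqP.
move=> u ut; rewrite E; last exact: ltn_trans (leq_ltn_trans le pl).
by rewrite (ltn_eqF (leq_trans ut le)) let_.
Qed.

(** At position [p.2] the new letter [p.1] no longer exceeds [t.1]. At later positions the letters
    of [m] are kept, as far as the shortened word reaches. *)
Lemma corner_mangle_gt m p (t : 'I_n * 'I_d) : mingen I m -> corner m p -> corner m t ->
  (p.1 < t.1)%N -> corner (mangle I m p.1) t = (p.2 < t.2 < mdeg (mangle I m p.1))%N.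
Proof.
move=> gm cp ct pt; have [_ _ E] := mangle_corner gm cp.
have le := corner_mono cp ct (ltnW pt).
move/cornerP: ct => [tm gt let_]; apply/cornerP/andP => [[lt gt' _]|[ptl lt]].
  split=> //; rewrite ltn_neqAle le andbT; apply/eqP => eq.
  by move: gt'; rewrite E // -eq eqxx ltnNge (ltnW pt).
split=> //; first by rewrite E // gtn_eqF.
move=> u ut; rewrite E ?(ltn_trans ut) //; case: eqP => _; [exact: ltnW|exact: let_].
Qed.

(** * Commutation and absorption of two moves *)

Section Swap.
Variables (F : {set 'I_n * 'I_d}) (m : 'X_{1..n}) (p q : 'I_n * 'I_d).
Hypotheses (adm : admissible I F m) (pF : p \in F) (qF : q \in F) (pq : (p.1 < q.1)%N).
Let mp := mangle I m p.1.
Let mq := mangle I m q.1.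
Let E := F :\ p :\ q.

Let gm : mingen I m. Proof. exact: admissible_gen adm. Qed.
Let cF t : t \in F -> corner m t. Proof. exact: admissible_corner adm. Qed.
Let ne : p != q. Proof. by apply: contraTneq pq => ->; rewrite ltnn. Qed.
Let EE : E = F :\ q :\ p. Proof. by rewrite /E !setDDl setUC. Qed.
Let qFp : q \in F :\ p. Proof. by rewrite !inE eq_sym ne. Qed.
Let pFq : p \in F :\ q. Proof. by rewrite !inE ne. Qed.
Let EF t : t \in E -> [/\ t \in F, t.1 != p.1 & t.1 != q.1].
Proof.
rewrite !inE => /and3P[tq tp tF]; split=> //.
  by apply: contra tp => /eqP/(corner_inj (cF tF) (cF pF))->.
by apply: contra tq => /eqP/(corner_inj (cF tF) (cF qF))->.
Qed.

(** By [corner_mangle_lt], the element [p] in the lower row is still a corner of [mq]. *)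
Lemma admissible_removed_lt : admissible I E mq = admissible I (F :\ q) mq.
Proof.
by rewrite EE [RHS](admissibleD1 _ pFq) corner_mangle_lt // cF.
Qed.

(** If [q] survives the move at [p], then [p.2 < q.2], and in either order the same two letters are
    replaced. *)
Lemma mangle_mangleC : corner mp q -> mangle I mp q.1 = mangle I mq p.1.
Proof.
move=> cq; have cp := corner_mangle_lt gm (cF qF) (cF pF) pq.
have [gmp _ Ep] := mangle_corner gm (cF pF); have [gmq _ Eq] := mangle_corner gm (cF qF).
have [gu /andP[_ ule] Eu] := mangle_corner gmp cq.
have [gv /andP[_ vle] Ev] := mangle_corner gmq cp.
move: cq; rewrite corner_mangle_gt ?cF // => /andP[pq2 _].
apply: (generator_ext I_borel gu gv) => t; rewrite leq_min => /andP[tu tv].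
rewrite Eu // Ev // Ep ?(leq_trans tu) // Eq ?(leq_trans tv) //.
by have [->|tp] := eqVneq t p.2; rewrite ?(ltn_eqF pq2).
Qed.

(** Either [q.2 = p.2], and the letter written at [q] is overwritten at [p], or [mp] is too short to
    reach the position [q.2]. In both cases no trace of the move at [q] is left on the common
    range. *)
Lemma mangle_mangle_absorb : ~~ corner mp q -> mangle I mq p.1 = mp.
Proof.
move=> ncq; have cp := corner_mangle_lt gm (cF qF) (cF pF) pq.
have [gmp _ Ep] := mangle_corner gm (cF pF); have [gmq _ Eq] := mangle_corner gm (cF qF).
have [gv /andP[_ vle] Ev] := mangle_corner gmq cp.
move: ncq; rewrite corner_mangle_gt ?cF // => ncq.
apply: (generator_ext I_borel gv gmp) => t; rewrite leq_min => /andP[tv tp].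
rewrite Ev // Eq ?(leq_trans tv) // Ep //.
case: eqVneq => // tp2; case: eqP => // tq2.
have le := corner_mono (cF pF) (cF qF) (ltnW pq).
by move: ncq; rewrite ltn_neqAle le andbT -tq2 tp andbT negbK eq_sym (negbTE tp2).
Qed.

(** An element in a row above [p] that is a corner after both moves is not at position [p.2], where
    the final letter is [p.1]; likewise for [q]. Its position lies in the word cut twice, hence in
    each word cut once. *)
Lemma admissible_mangleC : corner mp q -> admissible I E (mangle I mp q.1) ->
  admissible I (F :\ p) mp && admissible I (F :\ q) mq.
Proof.
move=> cq aE; have uv := mangle_mangleC cq.
have cp := corner_mangle_lt gm (cF qF) (cF pF) pq.
have [gmp _ Ep] := mangle_corner gm (cF pF); have [gmq _ Eq] := mangle_corner gm (cF qF).
have [gu /andP[_ ule] Eu] := mangle_corner gmp cq.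
have [gv /andP[pv vle] Ev] := mangle_corner gmq cp.
have := cq; rewrite corner_mangle_gt ?cF // => /andP[pq2 _].
rewrite -admissible_removed_lt (admissibleD1 _ qFp) cq /= -/E !admissibleE gmp gmq /=.
apply/andP; split; apply/forall_inP => t tE; have [tF tp tq] := EF tE.
  have [tlt|plt] := ltnP t.1 p.1; first by rewrite corner_mangle_lt ?cF.
  rewrite corner_mangle_gt ?cF //; last by rewrite ltn_neqAle eq_sym tp.
  have /cornerP[tu gtu _] := admissible_corner aE tE.
  rewrite (leq_trans tu) // andbT ltn_neqAle (corner_mono (cF pF) (cF tF)) // andbT.
  apply/eqP => E2; move: gtu; rewrite -E2 uv Ev // eqxx.
  by rewrite ltnNge plt.
have [tlt|qlt] := ltnP t.1 q.1; first by rewrite corner_mangle_lt ?cF.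
rewrite corner_mangle_gt ?cF //; last by rewrite ltn_neqAle eq_sym tq.
have /cornerP[tu gtu _] := admissible_corner aE tE.
rewrite (leq_trans _ vle) -?uv // andbT ltn_neqAle (corner_mono (cF qF) (cF tF)) // andbT.
apply/eqP => E2; move: gtu tu; rewrite -E2 => gtu tu; move: gtu.
by rewrite Eu // eqxx ltnNge qlt.
Qed.

(** An element above [q] that is a corner of [mp] lies strictly after [p.2] and inside [mp]. If
    [q.2 = p.2], it lies after [q.2]; otherwise [mp] ends at or before [q.2], and no such element
    exists. *)
Lemma admissible_absorb : ~~ corner mp q -> admissible I E mp -> admissible I (F :\ q) mq.
Proof.
move=> ncq aE; have v := mangle_mangle_absorb ncq.
have cp := corner_mangle_lt gm (cF qF) (cF pF) pq.
have [gmq _ Eq] := mangle_corner gm (cF qF).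
have [_ /andP[_ vle] _] := mangle_corner gmq cp; rewrite v in vle.
rewrite -admissible_removed_lt admissibleE gmq /=.
apply/forall_inP => t tE; have [tF tp tq] := EF tE.
have [tlt|qlt] := ltnP t.1 q.1; first by rewrite corner_mangle_lt ?cF.
have {}qlt : (q.1 < t.1)%N by rewrite ltn_neqAle eq_sym tq.
rewrite corner_mangle_gt ?cF //.
have := admissible_corner aE tE.
rewrite corner_mangle_gt ?cF ?(ltn_trans pq) // => /andP[pt tl].
rewrite (leq_trans tl) // andbT; move: ncq; rewrite corner_mangle_gt ?cF // negb_and -!leqNgt.
case/orP => [qp|lq]; first exact: leq_ltn_trans pt.
by have := leq_trans tl lq; rewrite ltnNge (corner_mono (cF qF) (cF tF)) // ltnW.
Qed.

End Swap.
End Symbols.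

(** The relation [r] selects one of each two opposite terms, and the pairs cancel. Nothing is
    divided by 2, so characteristic 2 is covered. *)
Lemma big_antisym (R : zmodType) (T : finType) (A : {set T}) (r : rel T) (H : T -> T -> R) :
  {in A &, forall x y, x != y -> r x y = ~~ r y x} ->
  {in A &, forall x y, x != y -> r x y -> H y x = - H x y} ->
  \sum_(x in A) \sum_(y in A :\ x) H x y = 0.
Proof.
move=> rP HP.
under eq_bigr => x _ do rewrite (bigID (r x)) /=.
rewrite big_split /= addrC [X in X + _](exchange_big_dep (mem A)) /=; last first.
  by move=> x y xA; rewrite !inE => /andP[/andP[_ ->]].
rewrite -big_split big1 //= => x xA.
rewrite (eq_bigl (fun y => (y \in A :\ x) && r x y)) => [|y]; last first.
  rewrite !inE xA andbT eq_sym; have [yA|] := boolP (y \in A); rewrite ?andbF //=.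
  by have [//|xy] := eqVneq; rewrite -rP // eq_sym.
rewrite -big_split big1 //= => y /andP[]; rewrite !inE => /andP[yx yA] xy.
by rewrite HP ?addNr // eq_sym.
Qed.

(** * The signs of the differential *)

Section Incidence.
Variables (K : fieldType) (n d : nat) (I : idealr {mpoly K[n]}).
Hypothesis I_borel : borel_fixed I.
Hypothesis I_deg : forall m, mingen I m -> (mdeg m <= d)%N.
Implicit Types (m : 'X_{1..n}) (F G : {set 'I_n * 'I_d}) (p q : 'I_n * 'I_d).

Notation cell := ({set 'I_n * 'I_d} * 'X_{1..n < d.+1})%type.
Implicit Types (b c e : cell).

(** On admissible pairs this is the scalar of [row_sign]: the exponent is the rank of [p] in the
    order of rows, counted from 1. *)
Definition sgn F p : K := (-1) ^+ #|[set q in F | (q.1 < p.1)%N]|.+1.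

Lemma sgn_sq F p : sgn F p * sgn F p = 1.
Proof. by rewrite -expr2 sqrr_sign. Qed.

Lemma sgnD1_lt F p q : p \in F -> (p.1 < q.1)%N -> sgn (F :\ p) q = - sgn F q.
Proof.
move=> pF pq; rewrite /sgn [X in _ = - (_ ^+ X.+1)](cardsD1 p) !inE pF pq /=.
rewrite add1n [in RHS]exprS mulN1r opprK; congr (_ ^+ _.+1).
by apply: eq_card => t; rewrite !inE andbA.
Qed.

Lemma sgnD1_ge F p q : (q.1 <= p.1)%N -> sgn (F :\ p) q = sgn F q.
Proof.
move=> qp; rewrite /sgn; congr (_ ^+ _.+1); apply: eq_card => t; rewrite !inE.
by case: eqP => // ->; rewrite ltnNge qp /= andbF.
Qed.

(** Removing [p] lowers the rank of [q] by one, while removing [q] leaves the rank of [p]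
    unchanged. *)
Lemma sgn_anti F p q : p \in F -> q \in F -> (p.1 < q.1)%N ->
  sgn F q * sgn (F :\ q) p = - (sgn F p * sgn (F :\ p) q).
Proof.
by move=> pF qF pq; rewrite (sgnD1_lt pF pq) (sgnD1_ge _ (ltnW pq)) mulrN opprK mulrC.
Qed.

Definition adm c : bool := admissible I c.1 c.2.

(** Summation over generators needs a finite type, hence the degree bound. The default [bm0] is not
    reached when the value is a minimal generator, by [I_deg]. *)
Definition bmangle m p : 'X_{1..n < d.+1} := insubd bm0 (mangle I m p.1).

Lemma val_bmangle m p : mingen I (mangle I m p.1) -> bmangle m p = mangle I m p.1 :> 'X_{1..n}.
Proof. by move=> /I_deg le; rewrite /bmangle -[LHS]/(val _) insubdK //; rewrite unfold_in ltnS. Qed.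

(* The entries of the differential with their monomial factors removed. *)
Definition inc c b : K :=
  if adm c then
    \sum_(p in c.1) sgn c.1 p *
      (((c.1 :\ p == b.1) && (bmnm c.2 == b.2))%:R
       - (admissible I (c.1 :\ p) (mangle I c.2 p.1)
          && ((c.1 :\ p == b.1) && (mangle I c.2 p.1 == b.2)))%:R)
  else 0.

Lemma sum_delta (T : finType) (g : T -> K) x : \sum_c (x == c)%:R * g c = g x.
Proof.
rewrite (bigD1 x) //= eqxx mul1r big1 ?addr0 // => c /negbTE cx.
by rewrite eq_sym cx mul0r.
Qed.

(** With [g] a column of incidences this computes the square of the differential; with [g] constant,
    the augmentation of a boundary. *)
Lemma sum_inc e (g : cell -> K) : adm e ->
  \sum_c inc e c * g c =
  \sum_(p in e.1) sgn e.1 p * (g (e.1 :\ p, e.2) -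
    (admissible I (e.1 :\ p) (mangle I e.2 p.1))%:R * g (e.1 :\ p, bmangle e.2 p)).
Proof.
move=> ae; under eq_bigr => c _ do rewrite /inc ae mulr_suml.
rewrite exchange_big /=; apply: eq_bigr => p pe.
rewrite -(sum_delta g (e.1 :\ p, e.2)) -(sum_delta g (e.1 :\ p, bmangle e.2 p)).
rewrite mulr_sumr -sumrB mulr_sumr; apply: eq_bigr => c _.
rewrite -mulrA mulrBl; congr (_ * (_ * _ - _)).
case: (boolP (admissible _ _ _)) => [/admissible_gen ga|_]; last by rewrite !mul0r.
by rewrite mul1r -[_ == c]/((_ == _) && (_ == _)) bmeqP val_bmangle.
Qed.

Lemma adm_face c p : adm c -> p \in c.1 -> adm (c.1 :\ p, c.2).
Proof. by rewrite /adm => ac pc; apply: admissible_sub ac; rewrite subD1set. Qed.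

Lemma inc_inc e b : \sum_c inc e c * inc c b = 0.
Proof.
have [ae|/negbTE ae] := boolP (adm e); last first.
  by rewrite big1 // => c _; rewrite /inc ae mul0r.
rewrite sum_inc //; case: e ae => F m ae /=.
have ge : mingen I m by exact: admissible_gen ae.
pose D m' : K := (m' == b.2 :> 'X_{1..n})%:R.
pose A F m' : K := (admissible I F m')%:R.
pose mg p := mangle I m p.1.
(* The four terms record which of the successive removals of [p] and [q] also move the generator. *)
pose G p q := D m - A (F :\ p :\ q) (mg q) * D (mg q)
   - A (F :\ p) (mg p) * (D (mg p)
       - A (F :\ p :\ q) (mangle I (mg p) q.1) * D (mangle I (mg p) q.1)).
pose H p q := sgn F p * sgn (F :\ p) q * ((F :\ p :\ q == b.1)%:R * G p q).
rewrite (eq_bigr (fun p => \sum_(q in F :\ p) H p q)) => [|p pF]; last first.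
  rewrite {1}/inc (@adm_face (F, m)) //=.
  have [ap|/negbTE ap] := boolP (admissible I (F :\ p) (mangle I m p.1)).
    have gp := admissible_gen ap; have vb := val_bmangle gp.
    have ab : adm (F :\ p, bmangle m p) by rewrite /adm /= vb.
    rewrite /inc ab /= vb mul1r -sumrB mulr_sumr; apply: eq_bigr => q qF.
    rewrite /H -!mulrA -mulrBr; congr (_ * (_ * _)).
    rewrite /G {2}/A /mg ap mul1r /D /A.
    by case: (_ == b.1); rewrite /= ?andbF ?mul0r ?subr0 // mul1r -!mulnb !natrM.
  rewrite mul0r subr0 mulr_sumr; apply: eq_bigr => q qF; rewrite /H -!mulrA.
  congr (_ * (_ * _)); rewrite /G {2}/A /mg ap mul0r subr0 /D /A.
  by case: (_ == b.1); rewrite /= ?andbF ?mul0r ?subr0 // mul1r -!mulnb !natrM.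
(* Removing p and q in the two orders gives opposite signs: it remains to see that G
   is symmetric.  If q is a corner of mg p, both moves commute; otherwise the move at
   q is absorbed by the later move at p. *)
apply: (@big_antisym _ _ _ (fun p q : 'I_n * 'I_d => p.1 < q.1)%N) => [p q pF qF|].
  rewrite -leqNgt => pq; rewrite ltn_neqAle; case: eqP => //= /val_inj E.
  by have := corner_inj (admissible_corner ae pF) (admissible_corner ae qF) E; move/eqP: pq.
move=> p q pF qF _ pq.
have EE : F :\ q :\ p = F :\ p :\ q by rewrite !setDDl setUC.
rewrite /H sgn_anti // EE mulNr; congr (- (_ * (_ * _))).
rewrite /G EE.
have [cq|ncq] := boolP (corner (mg p) q).
  rewrite (mangle_mangleC I_borel ae pF qF pq cq) -/(mg q).
  have := admissible_mangleC I_borel ae pF qF pq cq.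
  rewrite (mangle_mangleC I_borel ae pF qF pq cq) -/(mg q) -/(mg p) /=.
  rewrite /A (admissible_removed_lt I_borel ae pF qF pq) -/(mg q).
  have -> : admissible I (F :\ p) (mg p) = admissible I (F :\ p :\ q) (mg p).
    rewrite (@admissibleD1 _ _ _ _ (F :\ p) _ q) ?cq // !inE qF andbT.
    by apply: contraTneq pq => ->; rewrite ltnn.
  case: (admissible _ _ (mangle I (mg q) p.1)) => [/(_ isT)/andP[-> ->]|_] /=; ring.
(* The set [F :\ p] contains [q], which is not a corner of [mg p]. *)
have -> : A (F :\ p) (mg p) = 0.
  rewrite /A; have -> : admissible I (F :\ p) (mg p) = false; last by [].
  rewrite (@admissibleD1 _ _ _ _ (F :\ p) _ q) ?(negbTE ncq) // !inE qF andbT.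
  by apply: contraTneq pq => ->; rewrite ltnn.
rewrite (mangle_mangle_absorb I_borel ae pF qF pq ncq) -/(mg p) -/(mg q).
have := admissible_absorb I_borel ae pF qF pq ncq.
rewrite /A (admissible_removed_lt I_borel ae pF qF pq) -/(mg q) -/(mg p).
case: (admissible I (F :\ p :\ q) (mg p)) => [/(_ isT)->|_] /=; ring.
Qed.

End Incidence.

(** * Multidegrees and linear quotients *)

Section Multidegree.
Variables (K : fieldType) (n d : nat) (I : idealr {mpoly K[n]}).
Hypothesis I_borel : borel_fixed I.
Hypothesis I_deg : forall m, mingen I m -> (mdeg m <= d)%N.
Variable a : nat -> nat.
Hypothesis a_mono : {homo a : i j / (i <= j)%N >-> (i <= j)%N}.
Implicit Types (m : 'X_{1..n}) (F G : {set 'I_n * 'I_d}) (p q : 'I_n * 'I_d).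

Notation cell := ({set 'I_n * 'I_d} * 'X_{1..n < d.+1})%type.
Implicit Types (b c e : cell).

Definition label_mon p : 'X_{1..#|labels n d a|} := mvar_on (to_label a p).

Definition relabel (u : 'X_{1..#|{: 'I_n * 'I_d}|}) : 'X_{1..#|labels n d a|} :=
  (\sum_(i < #|{: 'I_n * 'I_d}|) label_mon (enum_val i) *+ u i)%MM.

Lemma relabelD u v : relabel (u + v)%MM = (relabel u + relabel v)%MM.
Proof.
apply/mnmP => k; rewrite mnmDE !mnm_sumE -big_split; apply: eq_bigr => i _.
by rewrite !mulmnE mnmDE mulnDr.
Qed.

Lemma relabel0 : relabel 0%MM = 0%MM.
Proof. by apply/mnmP => k; rewrite mnm_sumE mnm0E big1 // => i _; rewrite mulmnE mnm0E muln0. Qed.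

Lemma relabel_le u v : (u <= v)%MM -> (relabel u <= relabel v)%MM.
Proof. by move=> uv; rewrite -(submK uv) relabelD lem_addl. Qed.

Lemma relabelB u v : (u <= v)%MM -> relabel (v - u)%MM = (relabel v - relabel u)%MM.
Proof. by move=> uv; rewrite -{2}(submK uv) relabelD addmK. Qed.

Lemma relabel_var p : relabel (mvar_on p) = label_mon p.
Proof.
apply/mnmP => k; rewrite mnm_sumE (bigD1 (enum_rank p)) //= mulmnE [mvar_on p _]mnm1E eqxx muln1.
rewrite enum_rankK big1 ?addn0 // => i /negbTE ip.
by rewrite mulmnE [mvar_on p _]mnm1E eq_sym ip muln0.
Qed.

Lemma relabel_bpol m : relabel (bpol d m) = mgamma d a m.
Proof.
rewrite /bpol (big_morph _ relabelD relabel0); apply: eq_bigr => j _.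
by case: onth => [i|]; rewrite ?relabel_var ?relabel0.
Qed.

Lemma onth_letter m (i : 'I_n) t :
  (onth (alpha m) t == Some i) = (t < mdeg m)%N && (letter m t == i).
Proof.
have [tm|mt] := ltnP t (mdeg m); last by rewrite onth_default ?size_alpha.
by rewrite -size_alpha in tm; rewrite /letter (nth_map i) // onthE (nth_map i).
Qed.

(** Position by position: the letter at [p.2] contributes the variable [p], and the others agree
    with those of [m]. Hence the truncated subtraction in [EKcoef] is an exact quotient. *)
Lemma bpol_mangle m p : mingen I m -> corner m p ->
  (bpol d (mangle I m p.1) <= mvar_on p + bpol d m)%MM.
Proof.
move=> gm cp; have [_ /andP[pl le] E] := mangle_corner I_borel gm cp.
rewrite /bpol (bigD1 p.2) //= [X in (_ <= _ + X)%MM](bigD1 p.2) //=.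
have -> : onth (alpha (mangle I m p.1)) p.2 = Some p.1.
  by apply/eqP; rewrite onth_letter pl E // eqxx /=.
rewrite -surjective_pairing; apply/mnm_lepP => k; rewrite !mnmDE leq_add2l.
apply: leq_trans (leq_addl _ _); rewrite !mnm_sumE; apply: leq_sum => j jp.
case Ei : onth => [i|]; last by rewrite mnm0E.
move/eqP: Ei; rewrite onth_letter => /andP[jl]; rewrite E // val_eqE (negbTE jp).
move=> lj.
by have /eqP-> : onth (alpha m) j == Some i by rewrite onth_letter (leq_trans jl) ?lj.
Qed.

Lemma mgamma_mangle m p : mingen I m -> corner m p ->
  (mgamma d a (mangle I m p.1) <= label_mon p + mgamma d a m)%MM.
Proof.
by move=> gm cp; rewrite -!relabel_bpol -relabel_var -relabelD relabel_le // bpol_mangle.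
Qed.

(** The multidegree for which the differential over T is homogeneous. *)
Definition multideg c : 'X_{1..#|labels n d a|} :=
  (mgamma d a c.2 + \sum_(p in c.1) label_mon p)%MM.

Lemma multidegD1 F (m : 'X_{1..n < d.+1}) p : p \in F ->
  multideg (F, m) = (label_mon p + multideg (F :\ p, m))%MM.
Proof. by move=> pF; rewrite /multideg /= (big_setD1 p pF) /= addmA [(mgamma _ _ _ + _)%MM]addmC addmA. Qed.

Lemma incP c b : inc I c b != 0 -> adm I c /\ exists2 p, p \in c.1 & c.1 :\ p = b.1 /\
  (bmnm c.2 = b.2 \/ mangle I c.2 p.1 = b.2 /\ admissible I b.1 b.2).
Proof.
rewrite /inc; case: ifPn => [ac nz|]; last by rewrite eqxx.
split=> //; apply: contrapT => none; case/eqP: nz; apply: big1 => p pF.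
case: eqP => /= [E|_]; last by rewrite andbF subrr mulr0.
case: eqP => /= [E'|_]; first by case: none; exists p; auto.
case: eqP => /= [E'|_]; last by rewrite andbF subrr mulr0.
case: (boolP (admissible _ _ _)) => [ab|_]; last by rewrite subrr mulr0.
by case: none; exists p => //; split=> //; right; rewrite -E -E'.
Qed.

Lemma inc_multideg c b : inc I c b != 0 -> [/\ adm I c, adm I b & (multideg b <= multideg c)%MM].
Proof.
move=> /incP[ac [p pF [bF H]]]; split=> //.
  by case: H => [mb|[]//]; rewrite /adm -bF -mb; exact: adm_face.
case: c ac pF bF H => F m ac pF /= bF H; rewrite (multidegD1 _ pF) /multideg /= -bF.
case: H => [<-|[<- _]]; first by rewrite lem_addl.
have := mgamma_mangle (admissible_gen ac) (admissible_corner ac pF).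
move=> /mnm_lepP le; apply/mnm_lepP => k; rewrite addmA.
by rewrite !mnmDE leq_add2r -mnmDE; exact: le.
Qed.

Lemma inc_card c b : inc I c b != 0 -> #|c.1| = #|b.1|.+1.
Proof. by move=> /incP[_ [p pF [<- _]]]; rewrite (cardsD1 p) pF. Qed.

(** A corner in a strictly higher row has a position at least as large, so its label is strictly
    larger because [a] is non-decreasing. *)
Lemma label_inj m p q : corner m p -> corner m q -> label_mon p = label_mon q -> p = q.
Proof.
move=> cp cq /eqP; rewrite eq_mnm1 => /eqP/enum_rank_inj/(congr1 val) /=; rewrite /label.
have [pq|qp|pq _] := ltngtP p.1 q.1.
- have := a_mono (corner_mono cp cq (ltnW pq)); lia.
- have := a_mono (corner_mono cq cp (ltnW qp)); lia.
- exact: corner_inj cp cq (val_inj pq).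
Qed.

(** By [label_inj], the variable of [p] is not the variable of another element of [F], so the bound
    can be checked separately at that variable and elsewhere. This keeps the cone below inside its
    strand. *)
Lemma multideg_le_add F (m : 'X_{1..n < d.+1}) p D : adm I (F, m) -> p \in F ->
  (multideg (F :\ p, m) <= D)%MM -> (mgamma d a m + label_mon p <= D)%MM ->
  (multideg (F, m) <= D)%MM.
Proof.
move=> aF pF /mnm_lepP le1 /mnm_lepP le2; apply/mnm_lepP => k; rewrite (multidegD1 _ pF) mnmDE.
have [->|kp] := eqVneq k (enum_rank (to_label a p)).
  have := le2 (enum_rank (to_label a p)); rewrite mnmDE; apply: leq_trans.
  rewrite addnC leq_add2r /multideg mnmDE mnm_sumE big1 ?addn0 // => q /setD1P[qp qF].
  apply/eqP; rewrite mnm1E eqb0; apply: contra qp => qp.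
  apply/eqP/(label_inj (admissible_corner aF qF) (admissible_corner aF pF)).
  by rewrite /label_mon /mvar_on (eqP qp).
by rewrite mnm1E eq_sym (negbTE kp); exact: le1.
Qed.

Lemma multideg_ge F (m : 'X_{1..n < d.+1}) p : p \in F ->
  (mgamma d a m + label_mon p <= multideg (F, m))%MM.
Proof.
move=> pF; rewrite (multidegD1 _ pF) /multideg /=; apply/mnm_lepP => k; rewrite !mnmDE; lia.
Qed.

(** A difference within the common range is required; by [generator_ext] this still compares any two
    distinct generators. *)
Definition lexlt m m' : Prop := exists t,
  [/\ (t < minn (mdeg m) (mdeg m'))%N, forall u, (u < t)%N -> letter m u = letter m' u
    & (letter m t < letter m' t)%N].

Lemma lexlt_trans m1 m2 m3 : lexlt m1 m2 -> lexlt m2 m3 -> lexlt m1 m3.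
Proof.
move=> [t1 [l1 e1 g1]] [t2 [l2 e2 g2]]; exists (minn t1 t2); split.
- by move: l1 l2; rewrite !leq_min !gtn_min; lia.
- by move=> u; rewrite leq_min => /andP[/e1-> /e2].
have [t12|t21|E] := ltngtP t1 t2.
- by rewrite -e2.
- by rewrite e1.
by rewrite E in g1 *; exact: ltn_trans g2.
Qed.

Lemma lexlt_irr m : ~ lexlt m m.
Proof. by case=> t [_ _]; rewrite ltnn. Qed.

Lemma lexlt_total m m' : mingen I m -> mingen I m' -> m != m' -> lexlt m m' \/ lexlt m' m.
Proof.
move=> gm gm' ne.
have ex : exists t, (t < minn (mdeg m) (mdeg m'))%N && (letter m t != letter m' t).
  apply: contrapT => none; case/eqP: ne; apply: (generator_ext I_borel gm gm') => t lt.
  by apply/eqP; apply: contrapT => /negP lne; apply: none; exists t; rewrite lt.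
case: (ex_minnP ex) => t /andP[tm ne_t] tmin.
have eq u : (u < t)%N -> letter m u = letter m' u.
  move=> ut; apply/eqP; apply: contraT => une; have := tmin u.
  by rewrite une (ltn_trans ut tm) leqNgt ut => /(_ isT).
by case: (ltngtP (letter m t) (letter m' t)) ne_t => // h _; [left|right]; exists t; split=> //;
  [rewrite minnC | move=> u /eq].
Qed.

Lemma mangle_lexlt m p : mingen I m -> corner m p -> lexlt (mangle I m p.1) m.
Proof.
move=> gm cp; have [_ /andP[pl le] E] := mangle_corner I_borel gm cp.
have /cornerP[_ gt _] := cp.
exists p.2; split; first by rewrite leq_min pl (leq_trans pl).
  by move=> u up; rewrite E ?(ltn_trans up) // ltn_eqF.
by rewrite E // eqxx.
Qed.

(* At the first position t where the words of w and m differ, the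
   letter of w is smaller, and the variable it contributes to mgamma w occurs in
   mgamma m only through the letters before t. *)
Lemma linear_quotients m w D : mingen I m -> mingen I w -> lexlt w m ->
  (mgamma d a m <= D)%MM -> (mgamma d a w <= D)%MM ->
  exists2 p, corner m p & (mgamma d a m + label_mon p <= D)%MM.
Proof.
move=> gm gw [t []]; rewrite leq_min => /andP[tw tm] eqt lt /mnm_lepP leD /mnm_lepP leD'.
have td : (t < d)%N by exact: leq_trans tm (I_deg gm).
pose p : 'I_n * 'I_d := (Ordinal (letter_lt tw), Ordinal td).
exists p.
  apply/cornerP; split=> //= u ut; rewrite -eqt //.
  by apply: letter_le; rewrite (ltnW ut).
apply/mnm_lepP => k; rewrite mnmDE mnm1E.
have [<-|_] := eqVneq; last by rewrite addn0.
rewrite addn1; apply: leq_trans (leD' _); rewrite /mgamma !mnm_sumE.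
rewrite (bigD1 (Ordinal td)) //= [X in (_ < X)%N](bigD1 (Ordinal td)) //=.
have -> : onth (alpha w) t = Some (Ordinal (letter_lt tw)).
  by apply/eqP; rewrite onth_letter tw /=.
rewrite [X in (_ < X + _)%N]mnm1E eqxx.
(* From position [t] on, the letters of [m] exceed the letter of [w] at [t], and the shifts are at
   least [a t], so the labels are strictly larger. *)
have zero (j : 'I_d) : (t <= j)%N ->
    (if onth (alpha m) j is Some i then mvar_on (to_label a (i, j)) else 0)%MM
      (enum_rank (to_label a p)) = 0%N.
  move=> tj; case Ei : onth => [i|]; last by rewrite mnm0E.
  move/eqP: Ei; rewrite onth_letter => /andP[jm /eqP ij]; rewrite mnm1E.
  apply/eqP; rewrite eqb0 (inj_eq enum_rank_inj); apply/eqP => /(congr1 val) /=.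
  rewrite /label /= -ij; have := a_mono tj; have := @letter_le _ m t j; rewrite tj jm.
  by move=> /(_ isT); lia.
rewrite (zero (Ordinal td)) // add0n add1n ltnS; apply: leq_sum => j jt.
have [tj|jt'] := leqP t j; first by rewrite zero.
case Ei : onth => [i|]; last by rewrite mnm0E.
move/eqP: Ei; rewrite onth_letter => /andP[jm /eqP ij].
have /eqP -> : onth (alpha w) j == Some i by rewrite onth_letter (ltn_trans jt') //= eqt ?ij.
by [].
Qed.

(** The place of a generator in lexicographic order, as a number on which the filtration can be
    indexed. *)
Definition rk m : nat := #|[set m' : 'X_{1..n < d.+1} | mingen I m' && `[< lexlt m' m >]]|.

Lemma rk_lt m m' : mingen I m -> lexlt m m' -> (rk m < rk m')%N.
Proof.
move=> gm lt; apply: proper_card; apply/properP; split.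
  apply/subsetP => w; rewrite !inE => /andP[-> /asboolP wm]; apply/asboolP.
  exact: lexlt_trans lt.
have md : (mdeg m < d.+1)%N by rewrite ltnS I_deg.
exists (BMultinom md); rewrite !inE /= gm; first exact/asboolP.
by apply/negP => /asboolP/lexlt_irr.
Qed.

Lemma rk_inj m m' : mingen I m -> mingen I m' -> rk m = rk m' -> m = m'.
Proof.
move=> gm gm' E; apply/eqP; apply: contraT => /(lexlt_total gm gm')[]/rk_lt;
  by rewrite E ltnn => ->.
Qed.

Lemma rk_mangle m p : mingen I m -> corner m p -> (rk (mangle I m p.1) < rk m)%N.
Proof.
move=> gm cp; have [gm' _ _] := mangle_corner I_borel gm cp.
exact: rk_lt gm' (mangle_lexlt gm cp).
Qed.

Lemma inc_rk c b : inc I c b != 0 -> (rk b.2 <= rk c.2)%N.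
Proof.
move=> /incP[ac [p pF [_ [->//|[<- _]]]]]; apply/ltnW/rk_mangle.
  exact: admissible_gen ac.
exact: admissible_corner ac pF.
Qed.

End Multidegree.

(** * Exactness of the strands *)

Section Strand.
Variables (K : fieldType) (n d : nat) (I : idealr {mpoly K[n]}).
Hypothesis I_borel : borel_fixed I.
Hypothesis I_deg : forall m, mingen I m -> (mdeg m <= d)%N.
Variable a : nat -> nat.
Hypothesis a_mono : {homo a : i j / (i <= j)%N >-> (i <= j)%N}.
Implicit Types (F G : {set 'I_n * 'I_d}) (p q : 'I_n * 'I_d).

Notation cell := ({set 'I_n * 'I_d} * 'X_{1..n < d.+1})%type.
Notation rk := (rk d I).
Implicit Types (b c e : cell) (m : 'X_{1..n < d.+1}) (X Y : cell -> K).

Definition bd X b : K := \sum_c X c * inc I c b.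

Lemma sum_setU1 (T : finType) (G : {set T}) (h : {set T} -> T -> K) :
  \sum_(F : {set T}) \sum_(p in F) (F :\ p == G)%:R * h F p = \sum_(p | p \notin G) h (p |: G) p.
Proof.
rewrite (exchange_big_dep predT) //= [RHS]big_mkcond; apply: eq_bigr => p _.
case: ifPn => pG.
  rewrite (bigD1 (p |: G)) ?setU11 //= setU1K // eqxx mul1r big1 ?addr0 // => F.
  case/andP=> pF ne; case: eqP => [E|]; last by rewrite mul0r.
  by rewrite -E setD1K // eqxx in ne.
rewrite big1 // => F pF; case: eqP => [E|]; last by rewrite mul0r.
by move: pG; rewrite -E !inE eqxx.
Qed.

Lemma sum_fiber (S T : finType) (g : S * T -> K) y :
  \sum_u (if u.2 == y then g u else 0) = \sum_x g (x, y).
Proof.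
rewrite (eq_bigr (fun u => if u.2 == y then g (u.1, u.2) else 0)) => [|[]//].
rewrite -(pair_bigA _ (fun x z => if z == y then g (x, z) else 0)).
by apply: eq_bigr => x _; rewrite -big_mkcond big_pred1_eq.
Qed.

(* Along the last generator in the support, the boundary is that of a simplex. *)
Lemma bd_top X G m : (forall c, X c != 0 -> adm I c /\ (rk c.2 <= rk m)%N) ->
  bd X (G, m) = \sum_(p | p \notin G) sgn K (p |: G) p * X (p |: G, m).
Proof.
move=> XP; rewrite -(sum_setU1 _ (fun F p => sgn K F p * X (F, m))).
rewrite /bd (eq_bigr (fun c => if c.2 == m then X c * inc I c (G, m) else 0)) => [|c _]; last first.
  case: eqP => // /eqP cm; have [->|/XP[ac rc]] := eqVneq (X c) 0; first by rewrite mul0r.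
  rewrite /inc ac big1 ?mulr0 // => p pc; rewrite -bmeqP (negbTE cm) andbF.
  case: eqP => [E|]; rewrite ?andbF ?subr0 ?mulr0 //=.
  case: eqP => [E'|]; rewrite ?andbF ?subr0 ?mulr0 //.
  have gc := admissible_gen ac.
  by have := rk_mangle I_borel I_deg gc (admissible_corner ac pc); rewrite E' ltnNge rc.
rewrite sum_fiber; apply: eq_bigr => F _.
have [->|/XP[ac rc]] := eqVneq (X (F, m)) 0.
  by rewrite mul0r big1 // => p _; rewrite !mulr0.
rewrite /inc ac mulr_sumr; apply: eq_bigr => p pF /=.
have gm := admissible_gen ac.
have lt := rk_mangle I_borel I_deg gm (admissible_corner ac pF).
have /negbTE -> : mangle I m p.1 != m by apply: contraTneq lt => /= ->; rewrite ltnn.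
by rewrite eqxx !andbF andbT subr0; ring.
Qed.

Lemma bd_bd X b : bd (bd X) b = 0.
Proof.
rewrite /bd; under eq_bigr => c _ do rewrite mulr_suml.
rewrite exchange_big big1 //= => e _.
by under eq_bigr => c _ do rewrite -mulrA; rewrite -mulr_sumr inc_inc // mulr0.
Qed.

(** For [e.1] a singleton, the faces are the empty set with the generator kept and with the
    generator moved, with opposite signs. *)
Lemma sum_inc_vertex e : #|e.1| = 1%N -> \sum_b inc I e b = 0.
Proof.
move=> e1; have [ae|/negbTE ae] := boolP (adm I e); last first.
  by rewrite big1 // => b _; rewrite /inc ae.
have := sum_inc I_deg (fun=> 1) ae; under eq_bigr => b _ do rewrite mulr1; move=> ->.
rewrite big1 // => p pe; have gm := admissible_gen ae.
have [gm' _ _] := mangle_corner I_borel gm (admissible_corner ae pe).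
have /cards1P[x ex] : #|e.1| == 1%N by rewrite e1.
have -> : e.1 :\ p = set0 by move: pe; rewrite ex inE => /eqP->; rewrite setDv.
suff -> : admissible I (set0 : {set 'I_n * 'I_d}) (mangle I e.2 p.1) by rewrite mulr1 subrr mulr0.
by rewrite admissibleE gm'; apply/forall_inP => q; rewrite inE.
Qed.

Lemma subr_neq0 (x y : K) : x - y != 0 -> x != 0 \/ y != 0.
Proof. by have [->|] := eqVneq x 0; have [->|] := eqVneq y 0; rewrite ?subrr ?eqxx; auto. Qed.

Lemma bd_support Y b : bd Y b != 0 -> exists2 c, Y c != 0 & inc I c b != 0.
Proof.
move=> nz; apply: contrapT => none; case/eqP: nz; apply: big1 => c _.
have [->|Yc] := eqVneq (Y c) 0; first by rewrite mul0r.
have [->|ic] := eqVneq (inc I c b) 0; first by rewrite mulr0.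
by case: none; exists c.
Qed.

(** * Contraction of the top simplex *)

Section Cone.
Variables (X : cell -> K) (m : 'X_{1..n < d.+1}) (p0 : 'I_n * 'I_d).
Hypothesis XP : forall c, X c != 0 -> adm I c /\ (rk c.2 <= rk m)%N.
Hypothesis X_cycle : forall b, bd X b = 0.
Hypothesis p0_corner : corner m p0.

(* The contraction of the simplex on the corners of m towards the vertex p0. *)
Definition cone c : K :=
  if [&& c.2 == m, p0 \in c.1 & adm I c] then sgn K c.1 p0 * X (c.1 :\ p0, m) else 0.

Lemma coneP c : cone c != 0 -> [/\ c.2 = m, p0 \in c.1, adm I c & X (c.1 :\ p0, m) != 0].
Proof.
rewrite /cone; case: ifPn => [/and3P[/eqP-> p0c ac]|]; last by rewrite eqxx.
by rewrite mulf_eq0 negb_or => /andP[].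
Qed.

(** The homotopy formula for a cone, in which the term from the boundary of [X] vanishes. If [p0] is
    not in [G], the only coface that contributes is [p0 |: G]. *)
Lemma bd_cone G : adm I (G, m) -> bd cone (G, m) = X (G, m).
Proof.
move=> aG; rewrite bd_top => [|c /coneP[-> _ ac _] //].
have gm : mingen I m by exact: admissible_gen aG.
have adm_add p : corner m p -> adm I (p |: G, m).
  move=> cp; rewrite /adm admissibleE gm; apply/forall_inP => q.
  by case/setU1P=> [->//|qG]; exact: admissible_corner aG qG.
have [p0G|p0G] := boolP (p0 \in G); last first.
  rewrite (bigD1 p0) //= [cone _]/cone /= eqxx setU11 adm_add //= mulrA sgn_sq mul1r.
  rewrite setU1K // big1 ?addr0 // => p /andP[pG pp0].
  by rewrite /cone /= !inE eq_sym (negbTE pp0) (negbTE p0G) /= andbF mulr0.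
(* For [p0] in [G], the cycle condition at [G :\ p0] expresses [X (G, m)] through the cells
   [p |: G :\ p0], which are the values of the cone at the cofaces [p |: G]. *)
have := X_cycle (G :\ p0, m); rewrite bd_top // (bigD1 p0) ?setD11 //= setD1K //.
rewrite (eq_bigl (fun p => p \notin G)) => [/eqP|p]; last first.
  by rewrite !inE; have [->|] := eqVneq p p0; rewrite ?p0G //= andbT.
rewrite addr_eq0 => /eqP E; rewrite -[RHS]mul1r -(sgn_sq K G p0) -mulrA E mulrN mulr_sumr.
rewrite -sumrN; apply: eq_bigr => p pG.
have pp0 : p != p0 by apply: contraNneq pG => ->.
rewrite /cone /= eqxx inE p0G orbT /=.
have EG : (p |: G) :\ p0 = p |: G :\ p0.
  by apply/setP => q; rewrite !inE; have [->|] := eqVneq q p0; rewrite ?[p0 == p]eq_sym ?(negbTE pp0).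
rewrite EG; case: ifPn => ap.
  have pF : p \in p |: G by rewrite setU11.
  have p0F : p0 \in p |: G by rewrite setU1r.
  have sE : sgn K (p |: G) p * sgn K G p0 = - (sgn K (p |: G) p0 * sgn K (p |: G :\ p0) p).
    have := @sgn_anti K n d (p |: G) p p0 pF p0F.
    have := @sgn_anti K n d (p |: G) p0 p p0F pF.
    rewrite EG setU1K //; case: (ltngtP p.1 p0.1) => [_ _ /(_ isT)->|_ /(_ isT)-> //|E1].
      by rewrite opprK.
    by case/eqP: pp0; exact: corner_inj (admissible_corner ap pF) p0_corner (val_inj E1).
  rewrite mulrA -[LHS]mul1r -(sgn_sq K G p0).
  have -> : forall x y z w : K, x * x * (y * z * w) = y * x * (x * z * w) by move=> *; ring.
  rewrite sE -[sgn K G p0 * _ * _]mulrA mulrA.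
  have -> : forall x y z w : K, - (x * y) * z * (x * w) = (x * x) * - (z * (y * w)) by move=> *; ring.
  by rewrite sgn_sq mul1r.
(* If [p |: G] is not admissible, then [p] is not a corner of [m], and [X] vanishes here too. *)
have [->|/XP[ap' _]] := eqVneq (X (p |: G :\ p0, m)) 0; first by rewrite !mulr0 oppr0.
by case/negP: ap; apply: adm_add; apply: admissible_corner ap' _; rewrite setU11.
Qed.

End Cone.

(** Induction on the bound [N] for the ranks of the generators in the support. For [q = 0] the cycle
    condition is the vanishing of the augmentation. *)
Lemma strand_exact D N (q : nat) X :
  (forall c, X c != 0 -> [/\ adm I c, #|c.1| = q, (multideg a c <= D)%MM & (rk c.2 < N)%N]) ->
  (q = 0%N -> \sum_c X c = 0) -> (forall b, bd X b = 0) ->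
  exists2 Y, forall c, Y c != 0 -> [/\ adm I c, #|c.1| = q.+1 & (multideg a c <= D)%MM]
           & forall b, X b = bd Y b.
Proof.
elim: N X => [|N IHN] X XP X0 Xcyc.
  exists (fun=> 0) => [c|b]; first by rewrite eqxx.
  rewrite /bd big1 => [|c _]; last by rewrite mul0r.
  by apply/eqP; apply: contraT => /XP[].
have [[c0 [Xc0 rc0]]|none] := pselect (exists c, X c != 0 /\ rk c.2 = N); last first.
  apply: IHN => // c Xc; have [ac cq cD cN] := XP c Xc; split=> //.
  by rewrite ltn_neqAle -ltnS cN andbT; apply/eqP => E; apply: none; exists c.
have [ac0 q0 D0 _] := XP _ Xc0; set m := c0.2 in rc0; have gm := admissible_gen ac0.
have XP' c : X c != 0 -> adm I c /\ (rk c.2 <= rk m)%N.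
  by move=> /XP[ac _ _]; rewrite rc0 ltnS.
have top c : adm I c -> rk c.2 = N -> c.2 = m.
  move=> ac rc; apply: val_inj; apply: (rk_inj I_borel I_deg) => //.
    exact: admissible_gen ac.
  by rewrite rc rc0.
have [[p0 cp0 le0]|nop] := pselect (exists2 p, corner m p & (mgamma d a m + label_mon a p <= D)%MM).
  (* Subtracting the boundary of the cone clears all cells at [m] and creates none of higher rank,
     so the induction hypothesis applies to [X1]. *)
  pose Y1 := cone X m p0; pose X1 c := X c - bd Y1 c.
  have Y1P c : Y1 c != 0 -> [/\ adm I c, #|c.1| = q.+1 & (multideg a c <= D)%MM].
    case: c => F m' /coneP[/= m'E p0F aF /XP[_ cq cD _]]; subst m'; split=> //.
      by rewrite /= (cardsD1 p0) p0F cq.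
    exact: (@multideg_le_add K n d I a a_mono F m p0 D).
  have bdP c : bd Y1 c != 0 -> [/\ adm I c, #|c.1| = q, (multideg a c <= D)%MM & (rk c.2 <= N)%N].
    case/bd_support => e Ye ice; have [ae eq eD] := Y1P e Ye.
    have [_ ac ce] := inc_multideg I_borel a ice; split=> //.
    - by have := inc_card ice; rewrite eq => -[].
    - exact: lepm_trans ce eD.
    by have [e2 _ _ _] := coneP Ye; rewrite -rc0 -e2 (inc_rk I_borel I_deg ice).
  have X1P c : X1 c != 0 -> [/\ adm I c, #|c.1| = q, (multideg a c <= D)%MM & (rk c.2 < N)%N].
    move=> X1c; have [ac cq cD cN] : [/\ adm I c, #|c.1| = q, (multideg a c <= D)%MM & (rk c.2 <= N)%N].
      by case: (subr_neq0 X1c) => [/XP[]|/bdP].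
    split=> //; rewrite ltn_neqAle cN andbT; apply: contra X1c => /eqP/(top c ac) cm.
    by case: c ac {cq cD cN} cm => F m' /= aF m'E; subst m'; rewrite /X1 bd_cone ?subrr.
  have [||Y2 Y2P Y2E] := IHN X1 X1P.
  - move=> q00; rewrite /X1 sumrB X0 // sub0r /bd exchange_big big1 ?oppr0 // => c _.
    rewrite -mulr_sumr; have [->|/Y1P[_ cq _]] := eqVneq (Y1 c) 0; first by rewrite mul0r.
    by rewrite sum_inc_vertex ?mulr0 // cq q00.
  - move=> b; rewrite /bd; under eq_bigr => c _ do rewrite mulrBl.
    by rewrite sumrB -/(bd X b) -/(bd (bd Y1) b) Xcyc bd_bd subrr.
  exists (fun c => Y1 c + Y2 c) => [c|b].
    by rewrite -[Y2 c]opprK => /subr_neq0; rewrite oppr_eq0 => -[/Y1P|/Y2P].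
  rewrite /bd; under eq_bigr => c _ do rewrite mulrDl.
  by rewrite big_split /= -/(bd Y1 b) -/(bd Y2 b) -Y2E /X1 addrC subrK.
(* No corner of [m] fits into [D], so cells at [m] have empty first component and [q = 0]. Another
   generator in the support would precede [m] and yield a corner by [linear_quotients]. Thus [X]
   lives on [c0] alone and its sum is nonzero. *)
exfalso; have e0 F : (multideg a (F, m) <= D)%MM -> adm I (F, m) -> F = set0.
  move=> FD aF; apply/eqP; rewrite -[_ == _]negbK; apply/negP => /set0Pn[p pF].
  case: nop; exists p; first exact: admissible_corner aF pF.
  exact: lepm_trans (multideg_ge a m pF) FD.
have c00 : c0.1 = set0 by apply: e0; rewrite -surjective_pairing.
have q00 : q = 0%N by rewrite -q0 c00 cards0.
have := X0 q00; rewrite (bigD1 c0) //= big1 ?addr0; first by move/eqP: Xc0.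
move=> c cne; apply/eqP; apply: contraT => Xc; have [ac cq cD cN] := XP c Xc.
have c1 : c.1 = set0 by apply/eqP; rewrite -cards_eq0 cq q00.
have ne : c.2 != m by apply: contra cne => /eqP E; rewrite [c]surjective_pairing [c0]surjective_pairing c1 c00 E.
have mgD (e : cell) : (multideg a e <= D)%MM -> (mgamma d a e.2 <= D)%MM.
  exact/lepm_trans/lem_addr.
have gc := admissible_gen ac.
case: nop; apply: (linear_quotients I_deg a_mono gm gc) => //; try exact: mgD.
have [//|/rk_lt lt] := lexlt_total I_borel gc gm ne.
by move: cN; rewrite ltnS -rc0 leqNgt lt.
Qed.

End Strand.

(** * Matrices with monomial entries *)

Section MonomialMatrices.
Variables (K : fieldType) (N : nat).
Implicit Types (D u v : 'X_{1..N}).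

(** A multihomogeneous matrix with scalar part [s]. The inequality makes the truncated subtraction
    exact wherever the scalar is nonzero. *)
Definition mon_entries (C B : finType) (dC : C -> 'X_{1..N}) (dB : B -> 'X_{1..N})
    (s : C -> B -> K) (f : C -> B -> {mpoly K[N]}) : Prop :=
  forall c b, f c b = s c b *: 'X_[dC c - dB b] /\ (s c b != 0 -> (dB b <= dC c)%MM).

Lemma mon_entries_comp (E C B : finType) dE dC dB s1 s0 f1 f0 :
  @mon_entries E C dE dC s1 f1 -> @mon_entries C B dC dB s0 f0 ->
  (forall e b, \sum_c s1 e c * s0 c b = 0) ->
  forall e b, \sum_c f1 e c * f0 c b = 0.
Proof.
move=> f1P f0P ss e b.
rewrite (eq_bigr (fun c => (s1 e c * s0 c b) *: 'X_[dE e - dB b])).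
  by rewrite -scaler_suml ss scale0r.
move=> c _; have [-> le1] := f1P e c; have [-> le0] := f0P c b.
have [->|/le1/mnm_lepP {}le1] := eqVneq (s1 e c) 0; first by rewrite mul0r !scale0r mul0r.
have [->|/le0/mnm_lepP {}le0] := eqVneq (s0 c b) 0; first by rewrite mulr0 !scale0r mulr0.
rewrite -scalerAl -scalerAr scalerA -mpolyXD; congr (_ *: 'X_[_]).
by apply/mnmP => k; rewrite mnmDE !mnmBE; have := le1 k; have := le0 k; lia.
Qed.

Definition strand (C : finType) (dC : C -> 'X_{1..N}) (v : C -> {mpoly K[N]}) D c : K :=
  if (dC c <= D)%MM then (v c)@_(D - dC c) else 0.

Lemma mcoeffMZX (p : {mpoly K[N]}) (x : K) u v :
  (p * (x *: 'X_[u]))@_v = if (u <= v)%MM then x * p@_(v - u) else 0.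
Proof.
rewrite -scalerAr mcoeffZ; case: ifPn => [uv|nuv].
  by rewrite -{1}[v](submK uv) [(_ + u)%MM]addmC mcoeffMX.
suff -> : (p * 'X_[u])@_v = 0 by rewrite mulr0.
apply/eqP; rewrite mcoeff_eq0; apply: contra nuv.
by rewrite (perm_mem (msuppMX _ _)) => /mapP[w _ ->]; exact: lem_addr.
Qed.

(** A cycle is split into its finitely many multihomogeneous strands, each is lifted over K, and the
    lifts are summed with their monomials. *)
Lemma mon_entries_exact (E C B : finType) dE dC dB s1 s0 f1 f0 :
  @mon_entries E C dE dC s1 f1 -> @mon_entries C B dC dB s0 f0 ->
  (forall D (x : C -> K), (forall c, x c != 0 -> (dC c <= D)%MM) ->
    (forall b, \sum_c x c * s0 c b = 0) ->
    exists2 y : E -> K, forall e, y e != 0 -> (dE e <= D)%MM &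
      forall c, x c = \sum_e y e * s1 e c) ->
  forall v : C -> {mpoly K[N]}, (forall b, \sum_c v c * f0 c b = 0) ->
  exists w : E -> {mpoly K[N]}, forall c, v c = \sum_e w e * f1 e c.
Proof.
move=> f1P f0P ex v v0.
have strand0 D b : \sum_c strand dC v D c * s0 c b = 0.
  have [bD|nbD] := boolP (dB b <= D)%MM; last first.
    rewrite big1 // => c _; rewrite /strand; case: ifPn => [cD|]; last by rewrite mul0r.
    have [_ le] := f0P c b; have [->|/le bc] := eqVneq (s0 c b) 0; first by rewrite mulr0.
    by case/negP: nbD; exact: lepm_trans cD.
  have := congr1 (mcoeff (D - dB b)%MM) (v0 b); rewrite mcoeff0 raddf_sum /= => E0.
  rewrite -[RHS]E0; apply: eq_bigr => c _; have [-> le] := f0P c b; rewrite mcoeffMZX.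
  have [->|/le bc] := eqVneq (s0 c b) 0; first by rewrite mulr0 mul0r if_same.
  have -> : (dC c - dB b <= D - dB b)%MM = (dC c <= D)%MM.
    apply/mnm_lepP/mnm_lepP => h k; have := h k; rewrite ?mnmBE;
      have := mnm_lepP bc k; have := mnm_lepP bD k; lia.
  rewrite /strand; case: ifP => [cD|]; last by rewrite mul0r.
  rewrite mulrC; congr (_ * (v c)@_ _); apply/mnmP => k; rewrite !mnmBE.
  have := mnm_lepP bc k; have := mnm_lepP bD k; have := mnm_lepP cD k; lia.
have supp D c : strand dC v D c != 0 -> (dC c <= D)%MM.
  by rewrite /strand; case: ifP; rewrite ?eqxx.
have {}ex D : exists y : E -> K, (forall e, y e != 0 -> (dE e <= D)%MM) /\
    forall c, strand dC v D c = \sum_e y e * s1 e c.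
  by have [y] := ex D _ (supp D) (strand0 D); exists y.
have [y yP] := choice ex.
(* All multidegrees with a nonzero strand, without repetition, so that each coefficient of [v] is
   recovered exactly once. *)
pose Ds := undup (flatten [seq [seq (dC c + u)%MM | u <- msupp (v c)] | c <- enum C]).
exists (fun e => \sum_(D <- Ds) y D e *: 'X_[D - dE e]) => c.
under eq_bigr => e _ do rewrite mulr_suml.
rewrite exchange_big /=.
rewrite (eq_bigr (fun D => strand dC v D c *: 'X_[D - dC c])) => [|D _]; last first.
  have [yD ->] := yP D; rewrite scaler_suml; apply: eq_bigr => e _.
  have [-> le] := f1P e c.
  have [->|/yD/mnm_lepP eD] := eqVneq (y D e) 0; first by rewrite mul0r !scale0r mul0r.
  have [->|/le/mnm_lepP ce] := eqVneq (s1 e c) 0; first by rewrite mulr0 !scale0r mulr0.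
  rewrite -scalerAl -scalerAr scalerA -mpolyXD; congr (_ *: 'X_[_]).
  by apply/mnmP => k; rewrite mnmDE !mnmBE; have := eD k; have := ce k; lia.
apply/mpolyP => u; rewrite raddf_sum /=.
under eq_bigr => D _ do rewrite mcoeffZ mcoeffX.
have DuE D : (strand dC v D c * (D - dC c == u)%MM%:R) = if D == (dC c + u)%MM then (v c)@_u else 0.
  rewrite /strand; case: (eqVneq D (dC c + u)%MM) => [->|ne].
    by rewrite lem_addr addmC addmK eqxx mulr1.
  case: ifP => [cD|]; last by rewrite mul0r.
  case: eqP => [E'|]; last by rewrite mulr0.
  by move: ne; rewrite -E' addmC submK // eqxx.
under eq_bigr => D _ do rewrite DuE.
rewrite -big_mkcond big_const_seq /=.
have -> : count (fun D => D == (dC c + u)%MM) Ds = ((dC c + u)%MM \in Ds).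
  by rewrite -(count_uniq_mem _ (undup_uniq _)).
case: (boolP (_ \in Ds)) => [|nin]; first by rewrite /= addr0.
apply/eqP; rewrite mcoeff_eq0; apply: contra nin => usupp.
rewrite mem_undup; apply/flattenP; exists [seq (dC c + u)%MM | u <- msupp (v c)].
  by apply/mapP; exists c; rewrite ?mem_enum.
by apply/mapP; exists u.
Qed.

End MonomialMatrices.

Lemma mpoly_rmorph_ext (K : fieldType) (N : nat) (R : comNzRingType)
    (f g : {rmorphism {mpoly K[N]} -> R}) :
  (forall x : K, f x%:MP = g x%:MP) -> (forall i, f 'X_i = g 'X_i) -> f =1 g.
Proof.
move=> fgC fgX p; rewrite [p]mpolyE !rmorph_sum; apply: eq_bigr => u _.
rewrite -mul_mpolyC !rmorphM fgC mpolyXE_id !rmorph_prod; congr (_ * _).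
by apply: eq_bigr => i _; rewrite !rmorphXn fgX.
Qed.

(** * The isomorphism with T *)

Section Relabeling.
Variables (K : fieldType) (n d : nat) (a : nat -> nat).
Notation S := {mpoly K[#|{: 'I_n * 'I_d}|]}.
Notation T := {mpoly K[#|labels n d a|]}.

Definition relabel_hom : S -> T :=
  comp_mpoly [tuple var_on K (to_label a (enum_val i)) | i < #|{: 'I_n * 'I_d}|].
HB.instance Definition _ := GRing.LRMorphism.on relabel_hom.

Lemma relabel_homC (x : K) : relabel_hom x%:MP = x%:MP.
Proof. exact: comp_mpolyC. Qed.

Lemma relabel_homZ (x : K) f : relabel_hom (x *: f) = x *: relabel_hom f.
Proof. exact: comp_mpolyZ. Qed.

Lemma relabel_homX u : relabel_hom 'X_[u] = 'X_[relabel a u].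
Proof.
rewrite /relabel_hom comp_mpolyX /relabel.
rewrite (big_morph (fun w => 'X_[w]) (@mpolyXD _ K) (@mpolyX0 _ K)).
by apply: eq_bigr => i _; rewrite tnth_mktuple -mpolyXn.
Qed.

Lemma relabel_hom_var p : relabel_hom (var_on K p) = var_on K (to_label a p).
Proof. by rewrite /var_on relabel_homX relabel_var. Qed.

Definition label_rep (l : labels n d a) : 'I_n * 'I_d := iinv (ssvalP l).

Lemma label_repK l : to_label a (label_rep l) = l.
Proof. by apply: val_inj; exact: f_iinv. Qed.

(** One variable is chosen for each label; modulo [Theta] the choice is immaterial. *)
Definition section_hom : T -> S :=
  comp_mpoly [tuple var_on K (label_rep (enum_val i)) | i < #|labels n d a|].
HB.instance Definition _ := GRing.LRMorphism.on section_hom.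

Lemma section_hom_var l : section_hom (var_on K l) = var_on K (label_rep l).
Proof. by rewrite /section_hom comp_mpolyXU nth_mktuple enum_rankK. Qed.

Lemma section_homK : cancel section_hom relabel_hom.
Proof.
apply: (mpoly_rmorph_ext (f := relabel_hom \o section_hom) (g := idfun)) => [x|i] /=.
  by rewrite /section_hom comp_mpolyC relabel_homC.
rewrite -(enum_valK i) -/(var_on K (enum_val i)).
by rewrite section_hom_var relabel_hom_var label_repK.
Qed.

Variable Theta : seq S.
Hypothesis Theta_basis : basis_of_subspace (linear_space K a) Theta.
Notation Q := {ideal_quot (theta_ideal Theta_basis)}.

Lemma relabel_hom_theta f : f \in theta_ideal Theta_basis -> relabel_hom f = 0.
Proof.
case/asboolP => s [sT ->]; rewrite raddf_sum big_seq big1 // => -[g t] /sT /= tT.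
rewrite [_ *: _]/(_ * _) rmorphM; have : in_span (fun w => w \in Theta) t.
  by exists [:: (1, t)]; rewrite big_seq1 scale1r; split=> // y; rewrite inE => /eqP->.
case/Theta_basis.2 => r [rL ->]; rewrite raddf_sum big_seq big1 ?mulr0 // => z /rL.
case=> p [p' [E zE]]; rewrite /= relabel_homZ zE rmorphB /= !relabel_hom_var.
by rewrite (_ : to_label a p = to_label a p') ?subrr ?scaler0 //; apply: val_inj.
Qed.

Lemma theta_var p p' : label a p = label a p' ->
  \pi_Q (var_on K p) = \pi_Q (var_on K p').
Proof.
move=> E; apply/eqP; rewrite -Quotient.idealrBE; apply/asboolP.
have /Theta_basis.2[s [sT ->]] : linear_space K a (var_on K p - var_on K p').
  exists [:: (1, var_on K p - var_on K p')]; rewrite big_seq1 scale1r; split=> // y.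
  by rewrite inE => /eqP->; exists p, p'.
exists [seq (y.1%:MP, y.2) | y <- s]; split=> [y /mapP[z zs ->]|]; first exact: sT zs.
by rewrite big_map; apply: eq_bigr => y _; rewrite -mul_mpolyC.
Qed.

Definition quot_hom (x : Q) : T := relabel_hom (repr x).

Lemma quot_hom_pi f : quot_hom (\pi_Q f) = relabel_hom f.
Proof.
apply/eqP; rewrite -subr_eq0 -rmorphB; apply/eqP/relabel_hom_theta.
by rewrite Quotient.idealrBE reprK.
Qed.

Lemma quot_hom_zmod : zmod_morphism quot_hom.
Proof.
move=> x y; rewrite -[x]reprK -[y]reprK -rmorphB !quot_hom_pi; exact: rmorphB.
Qed.

Lemma quot_hom_monoid : monoid_morphism quot_hom.
Proof.
split=> [|x y]; first by rewrite -(rmorph1 \pi_Q) quot_hom_pi rmorph1.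
rewrite -[x]reprK -[y]reprK -rmorphM !quot_hom_pi; exact: rmorphM.
Qed.

HB.instance Definition _ := GRing.isZmodMorphism.Build Q T quot_hom quot_hom_zmod.
HB.instance Definition _ := GRing.isMonoidMorphism.Build Q T quot_hom quot_hom_monoid.

(** The inverse is [section_hom] followed by the projection: a variable and the chosen one of the
    same label differ by an element of the linear space, hence agree in the quotient. *)
Lemma quot_hom_bij : bijective quot_hom.
Proof.
exists (fun t => \pi_Q (section_hom t)) => [x|t]; last first.
  by rewrite quot_hom_pi section_homK.
rewrite -[x]reprK quot_hom_pi; move: (repr x).
apply: (mpoly_rmorph_ext (f := \pi_Q \o section_hom \o relabel_hom) (g := \pi_Q)) => [c|i] /=.
  by rewrite relabel_homC /section_hom comp_mpolyC.
rewrite -(enum_valK i) -/(var_on K (enum_val i)) relabel_hom_var section_hom_var.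
apply: theta_var; have /(congr1 val) := label_repK (to_label a (enum_val i)); exact.
Qed.

End Relabeling.

(** * The resolution *)

Section Resolution.
Variables (K : fieldType) (n d : nat) (I : idealr {mpoly K[n]}).
Hypothesis I_borel : borel_fixed I.
Hypothesis I_deg : forall m, mingen I m -> (mdeg m <= d)%N.
Variable a : nat -> nat.
Hypothesis a_mono : {homo a : i j / (i <= j)%N >-> (i <= j)%N}.
Implicit Types (m : 'X_{1..n}) (F G : {set 'I_n * 'I_d}) (p : 'I_n * 'I_d).
Notation cell := ({set 'I_n * 'I_d} * 'X_{1..n < d.+1})%type.
Notation T := {mpoly K[#|labels n d a|]}.
Notation basis := (EKbasis I d).

(** Rows are distinct on an admissible pair, so the elements listed before [p] are exactly those in
    lower rows. *)
Lemma index_by_row F m p : admissible I F m -> p \in F ->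
  index p (by_row F) = #|[set q in F | (q.1 < p.1)%N]|.
Proof.
move=> aF pF; have /and4P[_ srt _ _] := aF.
have rowP : pairwise (fun p q : 'I_n * 'I_d => p.1 < q.1)%N (by_row F).
  by move: srt; rewrite sorted_map sorted_pairwise // => x y z; exact: ltn_trans.
have -> : #|[set q in F | (q.1 < p.1)%N]| =
          count (fun q : 'I_n * 'I_d => q.1 < p.1)%N (by_row F).
  rewrite /by_row (permP (permEl (perm_sort _ _))) -size_filter cardE.
  apply/perm_size/uniq_perm => [||q]; first exact: enum_uniq.
    exact/filter_uniq/enum_uniq.
  by rewrite mem_enum mem_filter mem_enum !inE andbC.
have pr : p \in by_row F by rewrite mem_sort mem_enum.
have : uniq (by_row F) by rewrite sort_uniq enum_uniq.
move: (by_row F) pr rowP => s /splitPr[s1 s2].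
rewrite pairwise_cat /= cat_uniq => /and4P[/allrelP s1p _ /allP ps2 _] /and3P[_ ps1 _].
rewrite index_cat; case: ifP => [ps|_]; first by rewrite /= ps in ps1.
rewrite /= eqxx addn0 count_cat /= ltnn add0n.
have /eqP -> : count (fun q : 'I_n * 'I_d => q.1 < p.1)%N s1 == size s1.
  by rewrite -all_count; apply/allP => q qs; apply: s1p; rewrite ?mem_head.
rewrite (_ : count _ s2 = 0%N) ?addn0 //; apply/eqP; rewrite -leqn0 leqNgt -has_count.
by apply/hasPn => q /ps2 pq; rewrite -leqNgt ltnW.
Qed.

Lemma relabel_row_sign F m p : admissible I F m -> p \in F ->
  relabel_hom a (row_sign K F p) = (sgn K F p)%:MP.
Proof.
by move=> aF pF; rewrite /row_sign (index_by_row aF pF) /sgn !rmorphXn !rmorphN1.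
Qed.

Lemma submD2r (N : nat) (u v w : 'X_{1..N}) : (u + w - (v + w) = u - v)%MM.
Proof. by apply/mnmP => k; rewrite !(mnmBE, mnmDE) subnDr. Qed.

Lemma relabel_EKcoef (c b : cell) : adm I c ->
  relabel_hom a (EKcoef I c.1 c.2 b.1 b.2) =
  inc I c b *: 'X_[multideg a c - multideg a b].
Proof.
case: c b => [F m] [F' m'] aF /=; have gm := admissible_gen aF.
rewrite /EKcoef rmorphB !rmorph_sum /inc aF /= !big_mkcondr -sumrB scaler_suml.
apply: eq_bigr => p pF; have cp := admissible_corner aF pF.
rewrite (multidegD1 a m pF) !rmorphM /= !(relabel_row_sign aF pF) relabel_hom_var relabel_homX.
rewrite !mul_mpolyC mulrBr scalerBl; congr (_ - _).
  have [/eqP E|ne] := boolP (_ && _); last by rewrite /= mulr0 scale0r.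
  move: E => /eqP/andP[/eqP<- /eqP mE]; rewrite /= mulr1; congr (_ *: 'X_[_]).
  by rewrite /multideg /= mE addmK.
have [E|ne] := boolP [&& _, _ & _]; last by rewrite /= mulr0 scale0r.
case/and3P: E => ap /eqP<- /eqP mE; rewrite /= mulr1; congr (_ *: 'X_[_]).
have le := bpol_mangle I_borel gm cp.
rewrite (relabelB _ le) relabelD relabel_var !relabel_bpol /multideg /= mE.
by rewrite addmA submD2r.
Qed.

Definition deg_basis q : basis q -> 'X_{1..#|labels n d a|} :=
  match q with 0 => fun=> 0%MM | q'.+1 => fun x => multideg a (val x) end.

(** The lowest differential has scalar part 1, so its strands are the augmentations appearing in
    [strand_exact]. *)
Definition inc_basis q : basis q.+1 -> basis q -> K :=
  match q with 0 => fun _ _ => 1 | q'.+1 => fun x y => inc I (val x) (val y) end.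

Lemma basis_adm q (c : basis q.+1) : adm I (val c) /\ #|(val c).1| = q.
Proof. by case: c => c /= /andP[? /eqP]. Qed.

Lemma EKdiff_entries q : mon_entries (@deg_basis q.+1) (@deg_basis q) (@inc_basis q)
  (fun c b => relabel_hom a (EKdiff c b)).
Proof.
case: q => [|q] c b; last first.
  have [ac _] := basis_adm c; split; first exact: relabel_EKcoef.
  by case/(inc_multideg I_borel a).
split=> [|_]; last by apply/mnm_lepP => k; rewrite mnm0E.
have [_ /eqP] := basis_adm c; rewrite cards_eq0 => /eqP c0.
by rewrite /= relabel_homX relabel_bpol scale1r /multideg c0 big_set0 addm0 subm0.
Qed.

(** Passes from the bases of the complex to all cells, on which incidences were studied. *)
Lemma sum_basis q (g : cell -> K) : (forall c, g c != 0 -> adm I c /\ #|c.1| = q) ->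
  \sum_(c : basis q.+1) g (val c) = \sum_c g c.
Proof.
move=> gP; rewrite [RHS](bigID (fun c => adm I c && (#|c.1| == q))) /= [X in _ = _ + X]big1 ?addr0.
  rewrite (reindex_omap val (insub : cell -> option (basis q.+1))) => [|c cP].
    by apply: eq_bigl => -[c cP] /=; rewrite insubT eqxx cP.
  by rewrite insubT.
by move=> c ncP; apply/eqP; apply: contraNT ncP => /gP[-> ->]; rewrite eqxx.
Qed.

Lemma inc_basis_comp q (e : basis q.+2) (b : basis q) :
  \sum_c inc_basis e c * inc_basis c b = 0.
Proof.
have [ae e1] := basis_adm e.
case: q e b ae e1 => [|q] e b ae e1 /=.
  under eq_bigr => c _ do rewrite mulr1.
  rewrite (sum_basis (g := inc I (val e))) => [|c nz].
    exact: sum_inc_vertex.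
  have [_ ac _] := inc_multideg I_borel a nz; split=> //.
  by have := inc_card nz; rewrite e1 => -[].
rewrite (sum_basis (g := fun c => inc I (val e) c * inc I c (val b))) => [|c].
  exact: inc_inc.
rewrite mulf_eq0 negb_or => /andP[nz _].
have [_ ac _] := inc_multideg I_borel a nz; split=> //.
by have := inc_card nz; rewrite e1 => -[].
Qed.

Lemma inc_basis_exact q D (x : basis q.+1 -> K) :
  (forall c, x c != 0 -> (deg_basis c <= D)%MM) ->
  (forall b, \sum_c x c * inc_basis c b = 0) ->
  exists2 y : basis q.+2 -> K, forall e, y e != 0 -> (deg_basis e <= D)%MM &
    forall c, x c = \sum_e y e * inc_basis e c.
Proof.
move=> xD x0; pose X (c : cell) : K := if insub c is Some c' then x c' else 0.
have XE (c : basis q.+1) : X (val c) = x c by rewrite /X valK.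
have XP c : X c != 0 -> [/\ adm I c, #|c.1| = q & (multideg a c <= D)%MM].
  rewrite /X; case: insubP => [c' _ <- /xD|]; last by rewrite eqxx.
  by have [] := basis_adm c'.
have sumX (g : cell -> K) : \sum_(c : basis q.+1) x c * g (val c) = \sum_c X c * g c.
  rewrite -(sum_basis (q := q)) => [|c].
    by apply: eq_bigr => c _; rewrite XE.
  by rewrite mulf_eq0 negb_or => /andP[/XP[]].
(* A rank counts monomials of degree at most [d], so their number bounds every rank. *)
have rkN (c : cell) : (rk d I c.2 < #|{: 'X_{1..n < d.+1}}|.+1)%N by rewrite ltnS max_card.
have [|||Y YP YE] := @strand_exact K n d I I_borel I_deg a a_mono D #|{: 'X_{1..n < d.+1}}|.+1 q X.
- by move=> c /XP[ac cq cD]; split=> //; exact: rkN.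
- move=> q0; subst q; have := x0 tt; rewrite (sumX (fun=> 1)) => E0; rewrite -[RHS]E0.
  by apply: eq_bigr => c _; rewrite mulr1.
- move=> b; case: q x xD x0 @X XE XP sumX => [|q] x xD x0 X XE XP sumX.
    rewrite /bd big1 // => c _; have [->|/XP[_ c0 _]] := eqVneq (X c) 0; first by rewrite mul0r.
    have [->|/inc_card] := eqVneq (inc I c b) 0; first by rewrite mulr0.
    by rewrite c0.
  have [/andP[ab bq]|nb] := boolP (adm I b && (#|b.1| == q)).
    have bP : admissible I b.1 b.2 && (#|b.1| == q) by rewrite bq andbT.
    by rewrite /bd -sumX; exact: (x0 (Sub b bP)).
  (* Outside the basis the cycle condition holds termwise: incidences reach only admissible pairs
     with one element fewer. *)
  rewrite /bd big1 // => c _; have [->|/XP[_ cq _]] := eqVneq (X c) 0; first by rewrite mul0r.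
  have [->|nz] := eqVneq (inc I c b) 0; first by rewrite mulr0.
  have [_ ab _] := inc_multideg I_borel a nz; case/negP: nb; rewrite ab /=.
  by have := inc_card nz; rewrite cq => -[->].
exists (fun e => Y (val e)) => [e /YP[]//|c].
rewrite -XE YE /bd (sum_basis (q := q.+1) (g := fun e => Y e * inc I e (val c))) // => e.
by rewrite mulf_eq0 negb_or => /andP[/YP[]].
Qed.

Lemma mdeg_mgamma m : (mdeg m <= d)%N -> mdeg (mgamma d a m) = mdeg m.
Proof.
move=> md; rewrite /mgamma mdeg_sum.
rewrite (eq_bigr (fun j : 'I_d => if (j < mdeg m)%N then 1 else 0)%N) => [|j _].
  by rewrite -big_mkcond (big_ord_narrow md) sum_nat_const card_ord muln1.
have [jm|mj] := ltnP j (mdeg m); last by rewrite onth_default ?mdeg0 // size_alpha.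
case E: onth => [i|]; first by rewrite mdeg1.
by move: jm; rewrite -size_alpha -onthTE E.
Qed.

Lemma mdeg_deg_basis q (c : basis q.+1) : mdeg (deg_basis c) = (mdeg (val c).2 + q)%N.
Proof.
have [ac cq] := basis_adm c; rewrite /= /multideg mdegD mdeg_mgamma; last first.
  exact/I_deg/(admissible_gen ac).
rewrite mdeg_sum (eq_bigr (fun=> 1%N)) => [|p _]; last by rewrite mdeg1.
by rewrite sum1_card cq.
Qed.

(** An [idealr] is proper, so 1 is not a generator. *)
Lemma mingen_mdeg_gt0 m : mingen I m -> (0 < mdeg m)%N.
Proof.
move=> /mingen_in; rewrite lt0n mdeg_eq0; apply: contraTneq => ->.
by rewrite /mon_in mpolyX0 idealr1.
Qed.

(** The source of minimality: a nonzero entry is a monomial of positive degree, since one corner is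
    removed and [mangle] does not raise the degree of the generator. *)
Lemma inc_basis_mdeg q (c : basis q.+1) (b : basis q) : inc_basis c b != 0 ->
  (mdeg (deg_basis b) < mdeg (deg_basis c))%N.
Proof.
rewrite (mdeg_deg_basis c); have [ac cq] := basis_adm c; have gc := admissible_gen ac.
case: q b c ac cq gc => [|q] b c ac cq gc nz.
  by rewrite /= mdeg0 addn0 mingen_mdeg_gt0.
rewrite mdeg_deg_basis addnS ltnS leq_add2r.
have [_ [p pc [_ [->//|[<- _]]]]] := incP nz.
by have [_ /andP[_ ->]] := mangle_corner I_borel gc (admissible_corner ac pc).
Qed.

(** * The augmentation onto the cyclic module *)

Section Augmentation.
Variables (R : comNzRingType) (X : R -> Prop).

Definition augmentation (v : {ffun unit -> R^o}) : quot_mod X := \pi_(quot_mod X) (v tt).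

Lemma augmentation_is_linear : linear augmentation.
Proof.
move=> k u v; rewrite /augmentation !ffunE raddfD; congr (_ + _).
exact/esym/quot_scale_pi.
Qed.

HB.instance Definition _ :=
  GRing.isLinear.Build R {ffun unit -> R^o} (quot_mod X) _ augmentation augmentation_is_linear.

Lemma augmentation_eq0 v : augmentation v = 0 <-> ideal_gen X (v tt).
Proof.
rewrite /augmentation -(raddf0 \pi_(quot_mod X)) -[Z in ideal_gen _ Z]subr0.
by split=> [/eqP/pi_eqP|/pi_eqP/eqP].
Qed.

End Augmentation.

Lemma irrelevant_monomial (N : nat) (u : 'X_{1..N}) (f : {mpoly K[N]}) :
  u != 0%MM -> irrelevant_ideal (f * 'X_[u]).
Proof.
rewrite -mdeg_eq0 -lt0n mdegE => u0; have [i ui] : exists i, u i != 0%N.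
  apply/existsP; rewrite -negb_forall; apply: contraTN u0 => /forallP h.
  by rewrite big1 // => i _; apply/eqP.
exists [:: (f * 'X_[u - U_(i)], 'X_i)]; split=> [p|].
  by rewrite inE => /eqP->; exists i.
by rewrite big_seq1 /= -[in LHS](submK (_ : U_(i) <= u)%MM) ?lep1mP // mpolyXD mulrA.
Qed.

Lemma ideal_gen_sum (R : comNzRingType) (X : R -> Prop) (C : finType) (f : C -> R) :
  (forall c, ideal_gen X (f c)) -> ideal_gen X (\sum_c f c).
Proof.
move=> fX; elim/big_ind: _ => [|x y Xx Xy|c _]; [exact: in_span0| |exact: fX].
by have := in_spanZD 1 Xx Xy; rewrite scale1r.
Qed.

(** * Extension of scalars to T *)

Section BaseChange.
Variables (Q : nzRingType) (pi : {rmorphism {mpoly K[#|{: 'I_n * 'I_d}|]} -> Q}).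
Variable psi : {rmorphism Q -> T}.
Hypothesis psi_pi : forall f, psi (pi f) = relabel_hom a f.
Notation C := (base_change psi (base_change pi (EKcomplex I d))).

Lemma base_change_entries q : mon_entries (@deg_basis q.+1) (@deg_basis q) (@inc_basis q)
  (fun c b => @fc_diff _ C q c b).
Proof. by move=> c b; rewrite /= psi_pi; exact: EKdiff_entries. Qed.

Lemma fc_diff0 c b : @fc_diff _ C 0 c b = 'X_[mgamma d a (val c).2].
Proof. by rewrite /= psi_pi relabel_homX relabel_bpol. Qed.

Lemma ideal_gammaP (f : T) : ideal_gen (gamma_gens I d a) f <->
  exists w : basis 1 -> T, f = \sum_c w c * @fc_diff _ C 0 c tt.
Proof.
split=> [[s [sX ->]]|[w ->]]; last first.
  apply: ideal_gen_sum => c; exists [:: (w c, @fc_diff _ C 0 c tt)].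
  rewrite big_seq1; split=> // p; rewrite inE => /eqP->.
  have [ac _] := basis_adm c; exists (val c).2; first exact: admissible_gen ac.
  exact: fc_diff0.
elim: s sX => [|[g x] s IHs] sX.
  by exists (fun=> 0); rewrite big_nil big1 // => c _; rewrite mul0r.
have [|w wE] := IHs; first by move=> p ps; apply: sX; rewrite inE ps orbT.
have /= [m gm xE] := sX _ (mem_head _ _).
have md : (mdeg m < d.+1)%N by rewrite ltnS I_deg.
have cP : admissible I (set0 : {set 'I_n * 'I_d}) m && (#|(set0 : {set 'I_n * 'I_d})| == 0%N).
  by rewrite cards0 eqxx andbT admissibleE gm; apply/forall_inP => p; rewrite inE.
pose c0 : basis 1 := exist _ (set0, BMultinom md) cP.
exists (fun c => w c + (if c == c0 then g else 0)).
pose fc c := @fc_diff _ C 0 c tt.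
rewrite (eq_bigr (fun c => w c * fc c + (if c == c0 then g else 0) * fc c)) => [|c _]; last first.
  exact: mulrDl.
rewrite big_split big_cons wE addrC /=; congr (_ + _).
rewrite (bigD1 c0) //= eqxx big1 ?addr0 => [|c /negbTE->]; last by rewrite mul0r.
by rewrite xE -(fc_diff0 c0 tt).
Qed.

Lemma EKcomplex_resolution : minimal_free_resolution C (gamma_gens I d a).
Proof.
have bdE q (v : free_mod C q.+1) b :
  boundary v b = \sum_c v c * @fc_diff _ C q c b by rewrite ffunE.
exists (@augmentation T (gamma_gens I d a)), (fun q (c : fc_basis C q) => mdeg (deg_basis c)).
split.
- split=> [y|v|q v].
  + exists [ffun=> repr y]; by rewrite /= /augmentation ffunE reprK.
  + have /= -> := augmentation_eq0 (gamma_gens I d a) v.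
    split=> [v0|[w ->]].
      have [w vE] := (ideal_gammaP _).1 v0.
      by exists [ffun c => w c]; apply/ffunP => -[]; rewrite vE [RHS]ffunE; apply: eq_bigr => c _; rewrite ffunE.
    by apply: (ideal_gammaP _).2; exists w; rewrite ffunE.
  + split=> [v0|[w ->]]; last first.
      apply/ffunP => b; rewrite bdE [RHS]ffunE.
      under eq_bigr => c _ do rewrite bdE mulr_suml.
      rewrite exchange_big big1 //= => e _; under eq_bigr => c _ do rewrite -mulrA.
      rewrite -mulr_sumr (mon_entries_comp (@base_change_entries q.+1) (@base_change_entries q)) ?mulr0 //.
      exact: inc_basis_comp.
    have [b|w wE] := mon_entries_exact (@base_change_entries q.+1) (@base_change_entries q)
      (@inc_basis_exact q) (v := v).
      by rewrite -bdE v0 ffunE.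
    exists [ffun e => w e]; apply/ffunP => c; rewrite bdE wE.
    by apply: eq_bigr => e _; rewrite ffunE.
- move=> b; exists 1; first by rewrite /= mdeg0 dhomog1.
  by rewrite /= /augmentation ffunE; case: b; rewrite eqxx.
- move=> q c b m; have [-> le] := base_change_entries c b.
  have [->|nz] := eqVneq (inc_basis c b) 0; first by rewrite scale0r msupp0.
  rewrite mcoeff_msupp mcoeffZ mcoeffX mulf_eq0 negb_or => /andP[_].
  by case: (_ =P m) => [<- _|]; [rewrite -mdegD submK ?le | rewrite eqxx].
- move=> q v b; rewrite bdE; apply: ideal_gen_sum => c.
  have [-> le] := base_change_entries c b.
  have [->|nz] := eqVneq (inc_basis c b) 0; first by rewrite scale0r mulr0; exact: in_span0.
  rewrite -mul_mpolyC mulrA; apply: irrelevant_monomial.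
  apply: contraTneq (inc_basis_mdeg nz) => E.
  by rewrite -(submK (le nz)) E add0m ltnn.
Qed.

End BaseChange.
End Resolution.

Theorem corollary4p5 (K : fieldType) (n d : nat) (I : idealr {mpoly K[n]})
    (I_monomial : monomial_ideal I) (I_borel : borel_fixed I)
    (I_deg : forall m, mingen I m -> (mdeg m <= d)%N) :
  (forall (a : nat -> nat) (a0 : a 0%N = 0%N)
          (a_mono : {homo a : i j / (i <= j)%N >-> (i <= j)%N})
          (Theta : seq {mpoly K[#|{: 'I_n * 'I_d}|]})
          (Theta_basis : basis_of_subspace (linear_space K a) Theta),
    let Q := {ideal_quot (theta_ideal Theta_basis)} in
    exists psi : {rmorphism Q -> {mpoly K[#|labels n d a|]}},
      [/\ bijective psi,
          forall c : K, psi (\pi_Q c%:MP) = c%:MP,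
          forall p : 'I_n * 'I_d, psi (\pi_Q (var_on K p)) = var_on K (to_label a p)
        & minimal_free_resolution
            (base_change psi
               (base_change \pi_Q (EKcomplex I d)))
            (gamma_gens I d a)])
  /\
  (forall (Theta : seq {mpoly K[#|{: 'I_n * 'I_d}|]})
          (Theta_basis : basis_of_subspace (linear_space K id) Theta),
    let Q := {ideal_quot (theta_ideal Theta_basis)} in
    exists psi : {rmorphism Q -> {mpoly K[#|labels n d id|]}},
      [/\ bijective psi,
          forall c : K, psi (\pi_Q c%:MP) = c%:MP,
          forall p : 'I_n * 'I_d, psi (\pi_Q (var_on K p)) = var_on K (to_label id p)
        & minimal_free_resolution
            (base_change psi
               (base_change \pi_Q (EKcomplex I d)))
            (sq_gens I d)]).
Proof.
have main a (a_mono : {homo a : i j / (i <= j)%N >-> (i <= j)%N}) Theta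
    (Theta_basis : basis_of_subspace (linear_space K a) Theta) :
    let Q := {ideal_quot (theta_ideal Theta_basis)} in
    exists psi : {rmorphism Q -> {mpoly K[#|labels n d a|]}},
      [/\ bijective psi,
          forall c : K, psi (\pi_Q c%:MP) = c%:MP,
          forall p : 'I_n * 'I_d, psi (\pi_Q (var_on K p)) = var_on K (to_label a p)
        & minimal_free_resolution (base_change psi (base_change \pi_Q (EKcomplex I d)))
            (gamma_gens I d a)].
  move=> Q; exists (@quot_hom K n d a Theta Theta_basis : {rmorphism Q -> _}); split.
  - exact: quot_hom_bij.
  - by move=> c; rewrite /= quot_hom_pi relabel_homC.
  - by move=> p; rewrite /= quot_hom_pi relabel_hom_var.
  - apply: (EKcomplex_resolution I_borel I_deg a_mono). exact: (@quot_hom_pi K n d a Theta Theta_basis).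
(* The squarefree case is the sequence a_i = i, that is, [id]. *)
by split=> [a _ a_mono|] Theta Theta_basis; [exact: main|apply: main].
Qed.
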